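(* Let $\mathcal{C}$ be a category with finite products, $k$ a field of characteristic $0$, and $H^{\bullet} : \mathcal{C}^{\mathrm{op}} \to \mathbf{GrVec}_{k}$ a functor satisfying Axiom 1 (cup product), Axiom 2 (K\''unneth formula) and Axiom 3 (finite-dimensionality) stated in the context. Let $X$ be an object of $\mathcal{C}$ and $\phi = \bigoplus_{i\ge 0}\phi_i$ a $k$-linear graded endomorphism (of degree $0$) of $H^\bullet(X)$. If $\dim_{k}(H^{\bullet}(X))$ is finite, so that $H^{i}(X) = 0$ for all $i > 2d$ for some $d$, then $$\sum_{n=0}^{\infty}L_{u}\left(\phi_{X^{n}}|_{H^{\bullet}(X^{n})^{S_{n}}}\right) t^{n} = \frac{\det(\mathrm{id}_{H^{1}(X)} - \phi_{1}ut)\,\det(\mathrm{id}_{H^{3}(X)} - \phi_{3}u^{3}t) \cdots \det(\mathrm{id}_{H^{2d-1}(X)} - \phi_{2d-1} u^{2d-1}t)}{\det(\mathrm{id}_{H^{0}(X)} - \phi_{0}t)\,\det(\mathrm{id}_{H^{2}(X)} - \phi_{2}u^{2}t) \cdots \det(\mathrm{id}_{H^{2d}(X)} - \phi_{2d}u^{2d}t)}.$$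
   Context: $\mathbf{GrVec}_k$ is the category of $\mathbb{Z}_{\ge 0}$-graded $k$-vector spaces with $k$-linear graded maps of degree $0$. Write $H^\bullet(X) = \bigoplus_{i\geq 0} H^i(X)$, and $f^* : H^\bullet(Y) \to H^\bullet(X)$ for the map induced by a morphism $f : X \to Y$. Axiom 1: every object $X$ has a cup product, i.e. $k$-bilinear maps $\cup : H^i(X) \times H^j(X) \to H^{i+j}(X)$ for all $i,j \ge 0$ with $a \cup b = (-1)^{ij}\, b \cup a$ for $a \in H^i(X)$, $b \in H^j(X)$; the cup product is associative and natural, i.e. $f^*(a\cup b) = f^*(a)\cup f^*(b)$ for all morphisms $f$. Axiom 2 (K\''unneth formula): for all objects $X, Y$, with projections $p_X, p_Y$ from $X\times Y$, there is an isomorphism $H^\bullet(X \times Y) \simeq H^\bullet(X) \otimes_k H^\bullet(Y)$ given by $p_X^*(a) \cup p_Y^*(b) \mapsto a \otimes b$ for homogeneous $a, b$. Axiom 3: $H^i(X)$ is finite-dimensional over $k$ for every object $X$ and every $i$. These give $H^\bullet(X^n) \simeq H^\bullet(X)^{\otimes n}$ via $p_1^*(a_1) \cup \cdots \cup p_n^*(a_n) \mapsto a_1 \otimes \cdots \otimes a_n$, with $p_1,\dots,p_n : X^n \to X$ the projections. The group $S_n$ acts on $X^n$ by permuting coordinates, and the induced linear action on $H^\bullet(X^n)$ is $g\cdot(p_1^*(a_1)\cup\cdots\cup p_n^*(a_n)) = p_{g(1)}^*(a_1)\cup\cdots\cup p_{g(n)}^*(a_n)$ for homogeneous $a_i$.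 $H^\bullet(X^n)^{S_n}$ is the graded subspace of invariants. A graded endomorphism $\phi$ of $H^\bullet(X)$ induces the graded endomorphism $\phi_{X^n}$ of $H^\bullet(X^n)$ given by $p_1^*(a_1)\cup\cdots\cup p_n^*(a_n) \mapsto p_1^*(\phi(a_1))\cup\cdots\cup p_n^*(\phi(a_n))$; it commutes with the $S_n$-action and so restricts to $\phi_{X^n}|_{H^\bullet(X^n)^{S_n}}$. For $n=0$, $H^\bullet(X)^{\otimes 0} = k$ in degree $0$, and the $n=0$ term of the series is $1$. For a graded endomorphism $\psi = \bigoplus_i \psi_i$ of a graded vector space with finite-dimensional homogeneous pieces, the Lefschetz series is $L_u(\psi) := \sum_{i\geq 0}(-u)^i\,\mathrm{Tr}(\psi_i) \in k[[u]]$. *)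

(* Defs.v *)
From HB Require Import structures.
From mathcomp Require Import all_boot all_order all_fingroup all_algebra.
From mathcomp Require Import boolp classical_sets.

Set Implicit Arguments.
Unset Strict Implicit.
Unset Printing Implicit Defensive.

Import GRing.Theory.
Local Open Scope ring_scope.

(* R[[x]], with the Cauchy product; k[[u]][[t]] is then fps (fps k). *)

Record fps (R : Type) := Fps { fcoef : nat -> R }.

HB.instance Definition _ (R : Type) := gen_eqMixin (fps R).
HB.instance Definition _ (R : Type) := gen_choiceMixin (fps R).

Lemma fpsP (R : Type) (f g : fps R) : (forall n, fcoef f n = fcoef g n) -> f = g.
Proof. by case: f g => [f] [g] /= /funext ->. Qed.

Section FpsZmod.
Variable R : zmodType.
Implicit Types f g h : fps R.

Definition fps0 : fps R := Fps (fun=> 0).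
Definition fps_add f g := Fps (fun n => fcoef f n + fcoef g n).
Definition fps_opp f := Fps (fun n => - fcoef f n).

Fact fps_addA : associative fps_add.
Proof. by move=> f g h; apply: fpsP => n /=; rewrite addrA. Qed.
Fact fps_addC : commutative fps_add.
Proof. by move=> f g; apply: fpsP => n /=; rewrite addrC. Qed.
Fact fps_add0 : left_id fps0 fps_add.
Proof. by move=> f; apply: fpsP => n /=; rewrite add0r. Qed.
Fact fps_addN : left_inverse fps0 fps_opp fps_add.
Proof. by move=> f; apply: fpsP => n /=; rewrite addNr. Qed.

HB.instance Definition _ :=
  GRing.isZmodule.Build (fps R) fps_addA fps_addC fps_add0 fps_addN.
End FpsZmod.

Section FpsConst.
Variable R : nzRingType.

Definition fpsC (c : R) : fps R := Fps (fun n => if n == 0%N then c else 0).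
Definition fpsX : fps R := Fps (fun n => (n == 1%N)%:R).
End FpsConst.

Section FpsRing.
Variable R : comNzRingType.
Implicit Types f g h : fps R.

Definition fps_mul f g :=
  Fps (fun n => \sum_(i < n.+1) fcoef f i * fcoef g (n - i)).

Let trunc n f : {poly R} := \poly_(i < n) fcoef f i.

Let fps_mul_trunc f g m n : (m < n)%N ->
  fcoef (fps_mul f g) m = (trunc n f * trunc n g)`_m.
Proof.
move=> lt_mn; rewrite coefM /=; apply: eq_bigr => i _.
rewrite !coef_poly (leq_ltn_trans _ lt_mn) ?leq_ord //.
by rewrite (leq_ltn_trans _ lt_mn) ?leq_subr.
Qed.

Fact fps_mulC : commutative fps_mul.
Proof.
by move=> f g; apply: fpsP => n; rewrite !(fps_mul_trunc _ _ (ltnSn n)) mulrC.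
Qed.

Fact fps_mulA : associative fps_mul.
Proof.
move=> f g h; apply: fpsP => n.
transitivity ((trunc n.+1 f * (trunc n.+1 g * trunc n.+1 h))`_n).
  rewrite coefM; apply: eq_bigr => i _.
  by rewrite coef_poly ltn_ord (@fps_mul_trunc g h _ n.+1) // ltnS leq_subr.
rewrite mulrA coefM; apply: eq_bigr => i _.
by rewrite [in RHS](@fps_mul_trunc f g _ n.+1) // coef_poly ltnS leq_subr.
Qed.

Fact fps_mul1 : left_id (fpsC 1) fps_mul.
Proof.
move=> f; apply: fpsP => n /=; rewrite big_ord_recl /= mul1r subn0.
by rewrite big1 ?addr0 // => i _; rewrite mul0r.
Qed.

Fact fps_mulDl : left_distributive fps_mul (@fps_add R).
Proof.
move=> f g h; apply: fpsP => n /=.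
by rewrite -big_split; apply: eq_bigr => i _; rewrite mulrDl.
Qed.

Fact fps_1neq0 : fpsC 1 != 0 :> fps R.
Proof.
apply/eqP => /(congr1 (fun f => fcoef f 0)) /= /eqP.
by rewrite oner_eq0.
Qed.

HB.instance Definition _ := GRing.Zmodule_isComNzRing.Build (fps R)
  fps_mulA fps_mulC fps_mul1 fps_mulDl fps_1neq0.
End FpsRing.

Section FpsUnitRing.
Variable R : comUnitRingType.
Implicit Types f g : fps R.

(* A series is invertible iff its constant coefficient is. The coefficients
   g_n of the inverse solve f_0 g_(n+1) = - \sum_(i <= n) f_(i+1) g_(n-i). *)
Definition fps_unit f := fcoef f 0 \is a GRing.unit.

Fixpoint fps_inv_seq f n : seq R :=
  if n is m.+1 then
    let s := fps_inv_seq f m in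
    rcons s (- (fcoef f 0)^-1 * \sum_(i < m.+1) fcoef f i.+1 * s`_(m - i))
  else [:: (fcoef f 0)^-1].

Definition fps_inv f :=
  if fps_unit f then Fps (fun n => (fps_inv_seq f n)`_n) else f.

Let size_inv_seq f n : size (fps_inv_seq f n) = n.+1.
Proof. by elim: n => //= n IHn; rewrite size_rcons IHn. Qed.

Let nth_inv_seq f m n : (m <= n)%N ->
  (fps_inv_seq f n)`_m = (fps_inv_seq f m)`_m.
Proof.
elim: n => [|n IHn]; first by rewrite leqn0 => /eqP->.
rewrite leq_eqVlt => /predU1P[-> //|lt_mn].
by rewrite /= nth_rcons size_inv_seq lt_mn IHn.
Qed.

Fact fps_mulV : {in fps_unit, left_inverse 1 fps_inv *%R}.
Proof.
move=> f Uf; rewrite mulrC /fps_inv /fps_unit [fcoef f 0 \is a _]Uf.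
apply: fpsP => -[|n] /=; first by rewrite big_ord1 /= mulrV.
rewrite big_ord_recl subn0 /= nth_rcons size_inv_seq ltnn eqxx.
rewrite mulrA mulrN mulrV // mulN1r addrC; apply/eqP; rewrite subr_eq0.
apply/eqP/eq_bigr => i _; rewrite /= /bump /= add1n subSS.
by rewrite (nth_inv_seq _ (leq_subr i n)).
Qed.

Fact fps_unitPl f g : g * f = 1 -> fps_unit f.
Proof.
move/(congr1 (fun h => fcoef h 0)); rewrite /= big_ord1 /= => gf1.
by apply/unitrPr; exists (fcoef g 0); rewrite mulrC.
Qed.

Fact fps_inv_out : {in [predC fps_unit], fps_inv =1 id}.
Proof. by move=> f; rewrite /fps_inv inE /=; case: ifP => // Uf /negP[]. Qed.

HB.instance Definition _ := GRing.ComNzRing_hasMulInverse.Build (fps R)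
  fps_mulV fps_unitPl fps_inv_out.
End FpsUnitRing.

Section LinearMaps.
Variable k : fieldType.

Definition lfmx (V : vectType k) (f : 'End(V)) : 'M[k]_(\dim {:V}) :=
  passmx.mxof (vbasis {:V}) (vbasis {:V}) f.

Definition lftrace (V : vectType k) (f : 'End(V)) : k := \tr (lfmx f).

(* This is f|_U when f maps U into U. *)
Definition lfrestrict (V : vectType k) (U : {vspace V}) (f : 'End(V)) :
  'End(subvs_of U) := linfun (vsproj U \o f \o vsval).

(* U \otimes V, in coordinates with respect to the chosen bases. *)
Definition tens (U V : vectType k) : vectType k := 'M[k]_(\dim {:U}, \dim {:V}).

Definition ptens (U V : vectType k) (a : U) (b : V) : tens U V :=
  (passmx.rVof (vbasis {:U}) a)^T *m passmx.rVof (vbasis {:V}) b.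
End LinearMaps.

Section Graded.
Variable k : fieldType.
Implicit Types V W : nat -> vectType k.

Definition gr_hom V W := forall i, 'Hom(V i, W i).
Definition gr_end V := gr_hom V V.

(* Homogeneous elements paired with their degree. Equations between elements
   whose degrees agree only propositionally are stated in this type. *)
Definition homog V := {i : nat & V i}.
Definition Homog V i (a : V i) : homog V := Tagged (fun i => V i : Type) a.
Definition gr_app V W (F : gr_hom V W) (x : homog V) : homog W :=
  Homog (F (tag x) (tagged x)).

(* \dim (\bigoplus_i V_i) = \sum_i \dim V_i is finite. *)
Definition gr_findim V :=
  exists b, forall m, (\sum_(i < m) \dim {:V i} <= b)%N.

(* (V \otimes W)_n = \bigoplus_(i + j = n) V_i \otimes W_j. *)
Definition bideg n := {p : 'I_n.+1 * 'I_n.+1 | p.1 + p.2 == n}%N.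
Definition bidegD i j : bideg (i + j) :=
  exist _ (Ordinal (leq_addr j i : i < (i + j).+1)%N,
           Ordinal (leq_addl i j : j < (i + j).+1)%N) (eqxx _).

Definition tens_piece V W n (p : bideg n) : vectType k :=
  tens (V (val p).1) (W (val p).2).

Definition gr_tens V W n := {dffun forall p : bideg n, tens_piece V W p}.
Definition gr_ptens V W i j (a : V i) (b : W j) : gr_tens V W (i + j) :=
  finfun (@dfwith _ (fun p => tens_piece V W p) (fun=> 0) (bidegD i j)
            (ptens a b)).

Definition lefschetz V (psi : gr_end V) : fps k :=
  Fps (fun i => (-1) ^+ i * lftrace (psi i)).
End Graded.

Record category := Category {
  obj :> Type;
  mor : obj -> obj -> Type;
  idm : forall X, mor X X;
  compm : forall X Y Z, mor Y Z -> mor X Y -> mor X Z;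
  comp1m : forall X Y (f : mor X Y), compm (idm Y) f = f;
  compm1 : forall X Y (f : mor X Y), compm f (idm X) = f;
  compA : forall X Y Z T (f : mor Z T) (g : mor Y Z) (h : mor X Y),
    compm f (compm g h) = compm (compm f g) h
}.

Record finite_products (C : category) := FiniteProducts {
  fprodo : forall I : finType, (I -> C) -> C;
  proj : forall (I : finType) (F : I -> C) i, mor (fprodo F) (F i);
  tupm : forall (I : finType) (F : I -> C) (Z : C),
    (forall i, mor Z (F i)) -> mor Z (fprodo F);
  proj_tupm : forall (I : finType) (F : I -> C) (Z : C)
    (f : forall i, mor Z (F i)) i, compm (proj F i) (tupm f) = f i;
  tupm_uniq : forall (I : finType) (F : I -> C) (Z : C)
    (f : forall i, mor Z (F i)) (h : mor Z (fprodo F)),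
    (forall i, compm (proj F i) h = f i) -> h = tupm f
}.

(* Functors C^op -> GrVec_k whose values have finite-dimensional homogeneous
   pieces: the latter is what vectType expresses. *)
Record gr_functor (k : fieldType) (C : category) := GrFunctor {
  gobj :> C -> nat -> vectType k;
  pull : forall X Y : C, mor X Y -> gr_hom (gobj Y) (gobj X);
  pull_id : forall (X : C) i, pull (idm X) i = \1%VF;
  pull_comp : forall (X Y Z : C) (g : mor Y Z) (f : mor X Y) i,
    pull (compm g f) i = (pull f i \o pull g i)%VF
}.

Record cup_product (k : fieldType) (C : category) (H : gr_functor k C) :=
  CupProduct {
  cup : forall (X : C) i j, {bilinear H X i -> H X j -> H X (i + j)%N};
  cupC : forall (X : C) i j (a : H X i) (b : H X j),
    Homog (cup X i j a b) = Homog ((-1) ^+ (i * j) *: cup X j i b a);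
  cupA : forall (X : C) i j l (a : H X i) (b : H X j) (c : H X l),
    Homog (cup X _ _ (cup X i j a b) c) = Homog (cup X _ _ a (cup X j l b c));
  pull_cup : forall (X Y : C) (f : mor X Y) i j (a : H Y i) (b : H Y j),
    pull H f (i + j)%N (cup Y i j a b) =
    cup X i j (pull H f i a) (pull H f j b)
}.

Section Cohomology.
Variables (k : fieldType) (C : category) (P : finite_products C).
Variables (H : gr_functor k C) (c : cup_product H).

Definition prod2 (X Y : C) : C := fprodo P (fun b : bool => if b then X else Y).
Definition proj1 (X Y : C) : mor (prod2 X Y) X :=
  proj P (fun b : bool => if b then X else Y) true.
Definition proj2 (X Y : C) : mor (prod2 X Y) Y :=
  proj P (fun b : bool => if b then X else Y) false.

Definition kunneth := forall X Y : C,
  exists kappa : forall n, H (prod2 X Y) n -> gr_tens (H X) (H Y) n,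
  [/\ forall n p, linear (fun v => kappa n v p),
      forall n, bijective (kappa n) &
      forall i j (a : H X i) (b : H Y j),
        kappa (i + j)%N
          (cup c _ i j (pull H (proj1 X Y) i a) (pull H (proj2 X Y) j b)) =
        gr_ptens a b].

Variable X : C.

Definition powo n : C := fprodo P (fun _ : 'I_n => X).
Definition powp n (i : 'I_n) : mor (powo n) X := proj P (fun _ : 'I_n => X) i.

Definition permm n (g : 'S_n) : mor (powo n) (powo n) :=
  tupm P (fun i => powp (g i)).

Definition invariants n i : {vspace H (powo n) i} :=
  (\bigcap_(g : 'S_n) fixedSpace (pull H (permm g) i))%VS.

Definition hcup (Y : C) (x y : homog (H Y)) : homog (H Y) :=
  Homog (cup c Y _ _ (tagged x) (tagged y)).

(* p_1^*(a_1) \cup ... \cup p_(n+1)^*(a_(n+1)); no unit for the cup product is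
   assumed, so at least one factor is needed. *)
Definition cross n (a : 'I_n.+1 -> homog (H X)) : homog (H (powo n.+1)) :=
  foldl (@hcup _) (gr_app (pull H (powp ord0)) (a ord0))
    [seq gr_app (pull H (powp (lift ord0 i))) (a (lift ord0 i)) | i : 'I_n].

Definition induces (phi : gr_end (H X)) n (Phi : gr_end (H (powo n.+1))) :=
  forall a, gr_app Phi (cross a) = cross (gr_app phi \o a).

(* phi_(X^(n+1)): under the Kunneth formula exactly one Phi is induced by phi,
   so that the default value 0 is not used. *)
Definition pow_end (phi : gr_end (H X)) n : gr_end (H (powo n.+1)) :=
  xget ((fun=> 0) : gr_end (H (powo n.+1))) [set Phi | induces phi Phi].

Definition pow_end_inv (phi : gr_end (H X)) n :
  gr_end (fun i => subvs_of (invariants n.+1 i)) :=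
  fun i => lfrestrict (invariants n.+1 i) (pow_end phi n i).

(* \sum_n L_u(phi_(X^n)|_(H(X^n)^(S_n))) t^n, whose term for n = 0 is 1 by
   convention. *)
Definition lefschetz_gen (phi : gr_end (H X)) : fps (fps k) :=
  Fps (fun n => if n is m.+1 then lefschetz (pow_end_inv phi m) else 1).

Definition det_factor (phi : gr_end (H X)) i : fps (fps k) :=
  let u := fpsC (fpsX k) in
  let t := fpsX (fps k) in
  \det (1%:M - (u ^+ i * t) *: map_mx (fun x => fpsC (fpsC x)) (lfmx (phi i))).
End Cohomology.

(* Main.v *)
Require Import Defs.
From HB Require Import structures.
From mathcomp Require Import all_boot all_order all_fingroup all_algebra.
From mathcomp Require Import boolp classical_sets.

Set Implicit Arguments.
Unset Strict Implicit.
Unset Printing Implicit Defensive.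

Import GRing.Theory.
Local Open Scope ring_scope.

(** Write $s_n$ for the Lefschetz series of $\phi_{X^n}$ on the invariants and
$s(t) = \sum_n s_n t^n$. Both sides of the formula solve the same first-order
linear differential equation with the same constant term, and in characteristic
$0$ such an equation has one solution.

On the determinant side, Jacobi's formula for the derivation
$\theta = t\,d/dt$ gives $\theta \det(1 - tB) = -T(B) \det(1 - tB)$ with
$T(B) = \sum_{k \ge 1} \mathrm{Tr}(B^k) t^k$ ([theta_det1B]). Put
$B_i = u^i \phi_i$; the even determinants stand in the denominator and the odd
ones in the numerator, so the equation to be proved is
$\theta s = (\sum_i (-1)^i T(B_i))\, s$, that is, Newton's identity
$(n+1) s_{n+1} = \sum_{k \le n} s_{n-k}\, p_{k+1}$ for the supertraces
$p_k = \sum_i (-1)^i \mathrm{Tr}(B_i^k)$.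

In characteristic $0$ the invariants are the image of the averaging projector
$E = \frac{1}{n!} \sum_g g$, so the trace of $\phi_{X^n}$ on them is the trace
of $\phi_{X^n} E$ on all of $H^\bullet(X^n)$. The latter is computed in the
cross products $e_f = e_{f(1)} \times \dots \times e_{f(n)}$ of basis elements
of $H^\bullet(X)$, indexed by maps $f$. The Kunneth formula is used only to
produce coordinate functionals $\lambda_f$ on $H^\bullet(X^n)$ that satisfy
$\lambda_f(a_1 \times \dots \times a_n) = \prod_j \lambda_{f(j)}(a_j)$ and
$v = \sum_f \lambda_f(v) e_f$ ([frame_pow]); these data compute traces
([lftrace_frame]).

A permutation $g$ maps a cross product to the permuted one up to a sign. As
$\phi$ has degree $0$, only those $f$ contribute whose degrees are constant on
the cycles of $g$, and for these the sign is the signature of the restriction of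
$g$ to the factors of odd degree ([hprod_perm], [ksign]). Hence $n!\,s_n$ is the
signed sum $\sum_g \sum_f \pm \prod_j M_{f(j), f(g(j))}$, where $M$ is the
block matrix of the $(-u)^i \phi_i$ ([ksum_lefschetz]). Following the cycle
through one point and removing its elements one after the other splits a power
of $M$ off this sum, which is Newton's identity ([ksum_newton]). *)

(** * Power series: the Euler derivation and determinants *)

Section FpsTheory.
Variable R : comNzRingType.
Implicit Types f g : fps R.

Lemma fcoefD f g n : fcoef (f + g) n = fcoef f n + fcoef g n.
Proof. by []. Qed.

Lemma fcoefN f n : fcoef (- f) n = - fcoef f n.
Proof. by []. Qed.

Lemma fcoefM f g n : fcoef (f * g) n = \sum_(i < n.+1) fcoef f i * fcoef g (n - i).
Proof. by []. Qed.

Lemma fcoef_sum (I : Type) (r : seq I) (p : pred I) (F : I -> fps R) n :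
  fcoef (\sum_(i <- r | p i) F i) n = \sum_(i <- r | p i) fcoef (F i) n.
Proof. exact: (big_morph (fun f => fcoef f n)). Qed.

Lemma fcoefMn f m n : fcoef (f *+ m) n = fcoef f n *+ m.
Proof. by elim: m => // m IHm; rewrite !mulrS fcoefD IHm. Qed.

Lemma fcoef0M f g : fcoef (f * g) 0 = fcoef f 0 * fcoef g 0.
Proof. by rewrite fcoefM big_ord1. Qed.

Lemma fcoef0_prod (I : Type) (r : seq I) (p : pred I) (F : I -> fps R) :
  fcoef (\prod_(i <- r | p i) F i) 0 = \prod_(i <- r | p i) fcoef (F i) 0.
Proof. exact: (big_morph (fun f => fcoef f 0) fcoef0M). Qed.

Lemma fcoefCM c f n : fcoef (fpsC c * f) n = c * fcoef f n.
Proof.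
rewrite fcoefM big_ord_recl /= subn0 big1 ?addr0 // => i _.
by rewrite mul0r.
Qed.

Lemma fpsCM (a b : R) : fpsC (a * b) = fpsC a * fpsC b.
Proof. by apply: fpsP => n; rewrite fcoefCM /=; case: eqP; rewrite ?mulr0. Qed.

Lemma fpsCX (a : R) n : fpsC (a ^+ n) = fpsC a ^+ n.
Proof. by elim: n => [|n IHn] //; rewrite !exprS fpsCM IHn. Qed.

Lemma fpsC_prod (I : finType) (F : I -> R) :
  fpsC (\prod_i F i) = \prod_i fpsC (F i).
Proof. exact: (big_morph (@fpsC R) fpsCM (erefl _)). Qed.

Lemma fpsC_sign n : fpsC ((-1) ^+ n) = (-1) ^+ n :> fps R.
Proof. by rewrite fpsCX; congr (_ ^+ _); apply: fpsP => -[|q] //=; rewrite oppr0. Qed.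

Lemma fcoefXM f n : fcoef (fpsX R * f) n.+1 = fcoef f n.
Proof.
rewrite fcoefM !big_ord_recl /= mul0r add0r subSS subn0 mul1r big1 ?addr0 // => i _.
by rewrite mul0r.
Qed.

Lemma fcoef0XM f : fcoef (fpsX R * f) 0 = 0.
Proof. by rewrite fcoef0M mul0r. Qed.

Lemma fcoefX m n : fcoef (fpsX R ^+ m) n = (n == m)%:R.
Proof.
elim: m n => [|m IHm] [|n] //; rewrite exprS ?fcoef0XM //.
by rewrite fcoefXM IHm.
Qed.

(** The Euler derivation $x\,d/dx$. *)
Definition theta f := Fps (fun n => fcoef f n *+ n).

Fact theta_is_additive : zmod_morphism theta.
Proof. by move=> f g; apply: fpsP => n; rewrite /= mulrnDl mulNrn. Qed.

HB.instance Definition _ :=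
  GRing.isZmodMorphism.Build (fps R) (fps R) theta theta_is_additive.

Lemma thetaM f g : theta (f * g) = theta f * g + f * theta g.
Proof.
apply: fpsP => n; rewrite fcoefD -[LHS]/(fcoef (f * g) n *+ n) !fcoefM.
rewrite -sumrMnl -big_split.
apply: eq_bigr => i _; rewrite /= mulrnAl mulrnAr -mulrnDr subnKC //.
by rewrite -ltnS ltn_ord.
Qed.

Lemma theta1 : theta 1 = 0.
Proof. by apply: fpsP => -[|n] //=; rewrite mul0rn. Qed.

Lemma theta_prod (I : finType) (F a : I -> fps R) :
  (forall i, theta (F i) = a i * F i) ->
  theta (\prod_i F i) = (\sum_i a i) * \prod_i F i.
Proof.
move=> Fa; elim/big_rec2: _ => [|i y z _ IH]; first by rewrite theta1 mul0r.
by rewrite thetaM Fa IH mulrDl -mulrA [F i * (y * z)]mulrCA.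
Qed.

(** As $P$ has no constant term, the coefficient of $x^{n+1}$ in $\theta y = P y$
expresses $(n+1) y_{n+1}$ through $y_0, \dots, y_n$. *)
Lemma theta_eq_uniq (P y z : fps R) :
    (forall n (x : R), x *+ n.+1 = 0 -> x = 0) -> fcoef P 0 = 0 ->
  fcoef y 0 = fcoef z 0 -> theta y = P * y -> theta z = P * z -> y = z.
Proof.
move=> tf P0 yz0 Ey Ez; apply: fpsP => n.
elim/ltn_ind: n => -[|n] IHn //; apply/eqP; rewrite -subr_eq0; apply/eqP.
apply: (tf n); rewrite mulrnBl.
move: (congr1 (fun f => fcoef f n.+1) Ey) (congr1 (fun f => fcoef f n.+1) Ez).
rewrite /= => -> ->; rewrite 2!(big_ord_recl n.+1) P0 !mul0r !add0r; apply/eqP.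
rewrite subr_eq0; apply/eqP/eq_bigr => i _.
by rewrite IHn // ltnS subSS leq_subr.
Qed.

End FpsTheory.

Lemma fps_mulrn_eq0 (k : fieldType) (char0 : [pchar k] =i pred0) n (x : fps k) :
  x *+ n.+1 = 0 -> x = 0.
Proof.
move=> xn; apply: fpsP => m; have := congr1 (fun f => fcoef f m) xn.
rewrite /= fcoefMn -mulr_natl => /eqP; rewrite mulf_eq0 => /orP[|/eqP //].
by rewrite (iffLR (pcharf0P k) char0).
Qed.

(** Absorbing $u^i$ into the matrix brings a factor of the formula into the form
$\det(1 - tB)$, to which the logarithmic derivative applies. *)
Lemma scale_map_fpsC (R : comNzRingType) m (L : 'M[R]_m) i :
  (fpsC (fpsX R) ^+ i * fpsX (fps R)) *: map_mx (fun x => fpsC (fpsC x)) L =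
  fpsX (fps R) *: map_mx (@fpsC (fps R)) (fpsX R ^+ i *: map_mx (@fpsC R) L).
Proof.
apply/matrixP => r s; rewrite [LHS]mxE [RHS]mxE.
rewrite [map_mx _ _ _ _ in LHS]mxE [map_mx _ _ _ _ in RHS]mxE ![in RHS]mxE.
rewrite (fpsCM (fpsX R ^+ i) (fpsC (L r s))) (fpsCX (fpsX R) i).
by rewrite [RHS]mulrCA [RHS]mulrA.
Qed.

Section Jacobi.
Variables (R : comNzRingType) (D : {additive R -> R}).
Hypothesis DM : forall x y, D (x * y) = D x * y + x * D y.
Hypothesis D1 : D 1 = 0.

Lemma derivation_prod (I : finType) (F : I -> R) :
  D (\prod_i F i) = \sum_i D (F i) * \prod_(j | j != i) F j.
Proof.
have Dseq (r : seq I) : uniq r ->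
  D (\prod_(i <- r) F i) = \sum_(i <- r) D (F i) * \prod_(j <- r | j != i) F j.
  elim: r => [|x r IHr] /=; first by rewrite !big_nil D1.
  case/andP=> xr ur; rewrite !big_cons DM IHr // eqxx; congr (_ * _ + _).
    rewrite big_seq [in RHS]big_seq_cond; apply: eq_bigl => j.
    by case jr: (j \in r) => //=; apply/esym; apply: contraNneq xr => <-.
  rewrite mulr_sumr big_seq [in RHS]big_seq; apply: eq_bigr => i ir.
  have xi : x != i by apply: contraNneq xr => ->.
  by rewrite big_cons xi mulrCA.
by rewrite Dseq ?index_enum_uniq.
Qed.

(** Jacobi's formula. Differentiating each term of the Leibniz expansion replaces
one row of $A$ by its derivative; expanding the resulting determinants along
these rows produces the cofactors of $A$. *)
Lemma derivation_det n (A : 'M[R]_n) : D (\det A) = \tr (map_mx D A *m \adj A).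
Proof.
pose B i := \matrix_(k, l) (if k == i then D (A k l) else A k l).
have DS (s : 'S_n) x : D ((-1) ^+ s * x) = (-1) ^+ s * D x.
  by case: (odd_perm s); rewrite ?expr1 ?expr0 ?mulN1r ?mul1r ?raddfN.
transitivity (\sum_i \det (B i)).
  rewrite /determinant raddf_sum exchange_big /=; apply: eq_bigr => s _.
  rewrite DS derivation_prod mulr_sumr; apply: eq_bigr => i _; congr (_ * _).
  rewrite [RHS](bigD1 i) //= mxE eqxx; congr (_ * _).
  by apply: eq_bigr => j /negPf ji; rewrite mxE ji.
rewrite /mxtrace; apply: eq_bigr => i _.
rewrite mxE (expand_det_row _ i); apply: eq_bigr => j _; rewrite !mxE eqxx.
congr (_ * _); rewrite /cofactor; congr (_ * \det _); apply/matrixP => k l; rewrite !mxE.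
by rewrite eq_sym (negPf (neq_lift i k)).
Qed.
End Jacobi.

Section DetLog.
Variable R : comNzRingType.

(** $-x\,d/dx \log \det(1 - xA) = \sum_{k \ge 1} \mathrm{Tr}(A^k) x^k$. *)
Definition tracelog m (A : 'M[R]_m) : fps R :=
  fpsX R * Fps (fun k => \tr (A ^+ k.+1)).

Lemma fcoef0_det m (A : 'M[fps R]_m) :
  fcoef (\det A) 0 = \det (map_mx (fun f => fcoef f 0) A).
Proof.
rewrite /determinant fcoef_sum; apply: eq_bigr => s _.
rewrite fcoef0M fcoef0_prod; congr (_ * _); last by apply: eq_bigr => i _; rewrite mxE.
by case: (odd_perm s).
Qed.

Variables (m : nat) (A : 'M[R]_m).
Let q : fps R := \det (1%:M - fpsX R *: map_mx (@fpsC R) A).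

Lemma fcoef0_det1B : fcoef q 0 = 1.
Proof.
rewrite fcoef0_det -[RHS](det1 _ m); congr (\det _); apply/matrixP => i j.
by rewrite !mxE fcoefD fcoefN fcoef0XM subr0 fcoefMn.
Qed.

(** The geometric series $G = \sum_k A^k x^k$ inverts $N = 1 - xA$, so the adjugate
of $N$ is $\det(N)\, G$, and Jacobi's formula becomes
$\theta \det N = - \det(N)\, \mathrm{Tr}(xAG)$. *)
Lemma theta_det1B : theta q = - tracelog A * q.
Proof.
pose N : 'M[fps R]_m := 1%:M - fpsX R *: map_mx (@fpsC R) A.
pose G := \matrix_(i, j) Fps (fun k => (A ^+ k) i j).
have NG : N *m G = 1%:M.
  rewrite mulmxBl mul1mx -scalemxAl; apply/matrixP => i j; rewrite !mxE.
  apply: fpsP => -[|k]; rewrite fcoefD fcoefN ?fcoef0XM ?fcoefXM /= ?subr0.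
    by rewrite fcoefMn expr0 mxE.
  rewrite fcoef_sum fcoefMn mul0rn; apply/eqP; rewrite subr_eq0; apply/eqP.
  rewrite exprS !mxE; apply: eq_bigr => l _.
  by rewrite !mxE fcoefCM.
have adjN : \adj N = q *: G.
  by rewrite -[LHS]mulmx1 -NG mulmxA mul_adj_mx mul_scalar_mx /q -/N.
pose D : {additive fps R -> fps R} := @theta R.
have DN : map_mx D N = - (fpsX R *: map_mx (@fpsC R) A).
  apply/matrixP => i l; rewrite !mxE raddfB raddfMn /= theta1 mul0rn sub0r.
  congr (- _); apply: fpsP => n.
  rewrite -[LHS]/(fcoef (fpsX R * fpsC (A i l)) n *+ n).
  by case: n => [|[|n]]; rewrite ?mulr1n ?fcoef0XM // fcoefXM mul0rn.
rewrite /q (derivation_det (D := D) (@thetaM R) (theta1 R)) -/N adjN DN.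
rewrite -scalemxAr mxtraceZ mulrC -/q mulNmx raddfN /= -scalemxAl mxtraceZ.
congr (- (_ * _) * _); apply: fpsP => k; rewrite /mxtrace fcoef_sum.
apply: eq_bigr => i _; rewrite exprS [in LHS]mxE [in RHS]mxE fcoef_sum.
by apply: eq_bigr => l _; rewrite !mxE fcoefCM.
Qed.
End DetLog.

(** * Koszul-signed sums over permutations *)

(** Inserts the point [j] into the cycle of the first point, just after it, when
[j] is not the first point itself, and as a fixed point otherwise; the remaining
points are permuted by [s]. All permutations arise in this way exactly once. *)
Definition insert_perm n (j : 'I_n.+1) (s : 'S_n) : 'S_n.+1 :=
  (tperm ord0 j * lift_perm j j s)%g.

Lemma insert_perm0 n (j : 'I_n.+1) s : insert_perm j s ord0 = j.
Proof. by rewrite permM tpermL lift_perm_id. Qed.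

Lemma insert_perm_inj n : injective (fun js : 'I_n.+1 * 'S_n => insert_perm js.1 js.2).
Proof.
move=> [j s] [j' s'] /= E; have jj' : j = j'.
  by rewrite -(insert_perm0 j s) E insert_perm0.
congr (_, _) => //; move: E; rewrite -jj' => /mulgI E; apply/permP => k.
have /permP/(_ (lift j k)) := E.
by rewrite !lift_perm_lift => /lift_inj.
Qed.

Lemma insert_perm_bij n : bijective (fun js : 'I_n.+1 * 'S_n => insert_perm js.1 js.2).
Proof.
apply: (inj_card_bij (@insert_perm_inj n)).
by rewrite card_prod card_ord !card_Sn factS.
Qed.

(** The inverse of insertion: deletes the image of the first point. *)
Definition skip_perm n (g : 'S_n.+1) : 'S_n :=
  odflt 1%g [pick s | insert_perm (g ord0) s == g].

Lemma insert_permK n (j : 'I_n.+1) s : skip_perm (insert_perm j s) = s.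
Proof.
rewrite /skip_perm insert_perm0; case: pickP => [s' /eqP /= E|/(_ s)].
  by have [] := @insert_perm_inj n (j, s') (j, s) E.
by rewrite eqxx.
Qed.

Lemma skip_permK n (g : 'S_n.+1) : insert_perm (g ord0) (skip_perm g) = g.
Proof.
have [h _ hK] := insert_perm_bij n; have := hK g; case: (h g) => j s /= <-.
by rewrite insert_permK insert_perm0.
Qed.

(** When [d] is invariant under [g], this is the parity of the restriction of [g]
to the points where [d] holds: each insertion into a cycle of such points
multiplies the permutation by a transposition. The recursive form is the one in
which both the sign of a permuted product and the recursion for the sums below
are available. *)
Fixpoint ksign n : 'S_n -> ('I_n -> bool) -> bool :=
  if n is m.+1 then fun g d =>
    ((g ord0 != ord0) && d ord0) (+) ksign (skip_perm g) (d \o lift (g ord0))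
  else fun _ _ => false.

Lemma ksign_insert n (j : 'I_n.+1) s d :
  ksign (insert_perm j s) d = ((j != ord0) && d ord0) (+) ksign s (d \o lift j).
Proof. by rewrite /= insert_permK insert_perm0. Qed.

Lemma eq_ksign n (g : 'S_n) d d' : d =1 d' -> ksign g d = ksign g d'.
Proof.
elim: n g d d' => //= n IHn g d d' dd'; rewrite dd'; congr (_ (+) _).
by apply: IHn => k /=.
Qed.

Arguments ksign : simpl never.

Section CycleSums.
Variables (R : comNzRingType) (I : finType) (odd_pt : pred I) (M : I -> I -> R).
Hypothesis M_even : forall x y, odd_pt x != odd_pt y -> M x y = 0.

Definition ksum n : R :=
  \sum_(g : 'S_n) \sum_(f : {ffun 'I_n -> I})
    (-1) ^+ ksign g (odd_pt \o f) * \prod_i M (f i) (f (g i)).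

(** The same sum with the cycle through the first point cut open: it leaves from
the label [a] and arrives at the label [b]. Equating [a] and [b] and summing
closes the cycle again. *)
Definition open_ksum n (a b : I) : R :=
  \sum_(g : 'S_n.+1) \sum_(f : {ffun 'I_n.+1 -> I} | f ord0 == a)
    (-1) ^+ ksign g (odd_pt \o f) *
    \prod_i M (f i) (if g i == ord0 then b else f (g i)).

Lemma ksum0 : ksum 0 = 1.
Proof.
rewrite /ksum (eq_bigr (fun=> 1)) => [|g _]; last first.
  rewrite (eq_bigr (fun=> 1)) => [|f _]; last by rewrite big_ord0 mulr1.
  by rewrite sumr_const cardT -cardE card_ffun card_ord.
by rewrite sumr_const cardT -cardE card_Sn.
Qed.

Lemma trace_open_ksum n : \sum_a open_ksum n a a = ksum n.+1.
Proof.
rewrite exchange_big; apply: eq_bigr => g _ /=.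
rewrite [RHS](partition_big (fun f : {ffun _} => f ord0) predT) //=.
apply: eq_bigr => a _; apply: eq_bigr => f /eqP fa; congr (_ * _).
by apply: eq_bigr => i _; case: eqP => // ->; rewrite fa.
Qed.

(** The labels that match insertion of [j]: the first point gets [a], and [j] gets
the label that the first point had before, so that the cut cycle is extended by
one step at its start. *)
Definition insert_pt n (j : 'I_n.+1) (a : I) (f : {ffun 'I_n -> I}) :
    {ffun 'I_n.+1 -> I} :=
  [ffun i => if unlift j (tperm ord0 j i) is Some k then f k else a].

Lemma insert_ptE n (j : 'I_n.+1) a f k : insert_pt j a f (tperm ord0 j (lift j k)) = f k.
Proof. by rewrite ffunE tpermK liftK. Qed.

Lemma insert_pt0 n (j : 'I_n.+1) a f : insert_pt j a f ord0 = a.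
Proof. by rewrite ffunE tpermL unlift_none. Qed.

Lemma reindex_insert_pt n (j : 'I_n.+1) a (F : {ffun 'I_n.+1 -> I} -> R) :
  \sum_(f : {ffun 'I_n.+1 -> I} | f ord0 == a) F f = \sum_f F (insert_pt j a f).
Proof.
rewrite (reindex (insert_pt j a)) /=.
  by apply: eq_bigl => f; rewrite insert_pt0 eqxx.
exists (fun f : {ffun _} => [ffun k => f (tperm ord0 j (lift j k))]) => [f _|f].
  by apply/ffunP => k; rewrite ffunE insert_ptE.
rewrite inE => /eqP fa; apply/ffunP => i; rewrite ffunE.
case: unliftP => [k Ei|Ei]; first by rewrite ffunE -Ei tpermK.
by rewrite -fa -(tpermK ord0 j i) Ei tpermR.
Qed.

Lemma open_ksum_insert n a b :
  open_ksum n a b = \sum_j \sum_(s : 'S_n) \sum_(f : {ffun 'I_n -> I})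
    (-1) ^+ ksign (insert_perm j s) (odd_pt \o insert_pt j a f) *
    (M a (if j == ord0 then b else insert_pt j a f j) *
     \prod_k M (f k) (if lift j (s k) == ord0 then b
                      else insert_pt j a f (lift j (s k)))).
Proof.
rewrite pair_big /open_ksum (reindex _ (onW_bij _ (insert_perm_bij n))) /=.
apply: eq_bigr => -[j s] _ /=; rewrite (reindex_insert_pt j).
apply: eq_bigr => f _; congr (_ * _).
rewrite (reindex (tperm ord0 j)) /=; last first.
  by apply: onW_bij; exists (tperm ord0 j); apply: tpermK.
rewrite (bigD1_ord j) //= tpermR insert_pt0 insert_perm0.
congr (_ * _); apply: eq_bigr => k _.
by rewrite insert_ptE permM tpermK lift_perm_lift.
Qed.

Lemma open_ksum0 a b : open_ksum 0 a b = M a b.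
Proof.
rewrite open_ksum_insert big_ord1 eqxx.
transitivity (M a b * ksum 0); last by rewrite ksum0 mulr1.
rewrite mulr_sumr; apply: eq_bigr => s _; rewrite mulr_sumr; apply: eq_bigr => f _.
by rewrite ksign_insert /= !big_ord0 mulrCA.
Qed.

(** Permutations of $n+2$ points are sorted by the image $j$ of the first point. If
it is fixed, the cut cycle is the single step from [a] to [b]. For each of the
$n+1$ other values of $j$, removing $j$ leaves a cut cycle that starts at the
label $c$ of $j$, after one step from $a$ to $c$ and one sign. *)
Lemma open_ksumS n a b :
  open_ksum n.+1 a b = ksum n.+1 * M a b +
    n.+1%:R * ((-1) ^+ odd_pt a * \sum_c M a c * open_ksum n c b).
Proof.
rewrite open_ksum_insert big_ord_recl eqxx; congr (_ + _).
  rewrite mulrC mulr_sumr; apply: eq_bigr => s _; rewrite mulr_sumr.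
  apply: eq_bigr => f _; rewrite mulrCA ksign_insert eqxx addFb.
  have fl k : insert_pt ord0 a f (lift ord0 k) = f k.
    by rewrite -[RHS](insert_ptE ord0 a) tperm1 perm1.
  congr (_ * (_ ^+ nat_of_bool _ * _)); first by apply: eq_ksign => k /=; rewrite fl.
  by apply: eq_bigr => k _; rewrite fl eq_sym (negPf (neq_lift _ _)).
rewrite -[in RHS](card_ord n.+1) -sumr_const mulr_suml; apply: eq_bigr => j0 _.
(* All the points other than the first contribute equally. *)
set j := lift ord0 j0; rewrite mul1r.
have j_neq0 : j != ord0 by rewrite eq_sym neq_lift.
have lj0 : lift j ord0 = ord0 :> 'I_n.+2.
  exact: val_inj.
rewrite mulr_sumr (eq_bigr (fun c => \sum_(s : 'S_n.+1)
  \sum_(f : {ffun 'I_n.+1 -> I} | f ord0 == c) (-1) ^+ odd_pt a * (M a c *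
     ((-1) ^+ ksign s (odd_pt \o f) *
    \prod_i M (f i) (if s i == ord0 then b else f (s i)))))); last first.
  move=> c _; rewrite !mulr_sumr; apply: eq_bigr => s _.
  by rewrite !mulr_sumr; apply: eq_bigr.
rewrite [RHS]exchange_big; apply: eq_bigr => s _ /=.
rewrite [LHS](partition_big (fun f : {ffun _} => f ord0) predT) //=.
apply: eq_bigr => c _; apply: eq_bigr => f /eqP fc.
have fj : insert_pt j a f j = c.
  by rewrite -fc -[RHS](insert_ptE j a) lj0 tpermL.
have flift k : k != ord0 -> insert_pt j a f (lift j k) = f k.
  move=> k0; rewrite -[RHS](insert_ptE j a) tpermD // ?neq_lift //.
  by rewrite -lj0 (inj_eq lift_inj) eq_sym.
rewrite fj.
(* The sign of the smaller sum sees c where the larger one sees a. *)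
have [ac|/M_even ->] := eqVneq (odd_pt a) (odd_pt c); last by rewrite !(mul0r, mulr0).
rewrite ksign_insert j_neq0 /= insert_pt0 signr_addb -mulrA; congr (_ * _).
rewrite mulrCA; congr (_ * (_ ^+ nat_of_bool _ * _)).
  apply: eq_ksign => k /=; have [->|k0] := eqVneq k ord0; last by rewrite flift.
  by rewrite lj0 insert_pt0 fc.
apply: eq_bigr => k _; have [->|k0] := eqVneq (s k) ord0; first by rewrite lj0 eqxx.
by rewrite -{1}lj0 (inj_eq lift_inj) (negPf k0) flift.
Qed.

(** The entry at [a], [b] of $(\sigma M)^k M$, where $\sigma$ is the
diagonal sign matrix of the odd labels. *)
Fixpoint walk k (a b : I) : R :=
  if k is k'.+1 then (-1) ^+ odd_pt a * \sum_c M a c * walk k' c b else M a b.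

Variable s : nat -> R.
Hypothesis ksumE : forall n, ksum n = s n *+ n`!.

(** The recursion for the cut sums, unrolled along the cut cycle. *)
Lemma open_ksumE n a b :
  open_ksum n a b = (\sum_(k < n.+1) s (n - k) * walk k a b) *+ n`!.
Proof.
elim: n a b => [|n IHn] a b.
  rewrite open_ksum0 big_ord1 /= -[s 0]mulr1n -(ksumE 0) ksum0 mul1r //.
rewrite open_ksumS big_ord_recl ksumE mulrnDl subn0 !mulrnAl mul1r; congr (_ + _).
rewrite factS mulnC mulrnA; congr (_ *+ n.+1).
under eq_bigr do rewrite IHn mulrnAr.
rewrite sumrMnl mulrnAr; congr (_ *+ _).
under eq_bigr do rewrite mulr_sumr.
rewrite exchange_big mulr_sumr; apply: eq_bigr => k _ /=.
rewrite /bump /= add1n subSS mulrCA; congr (_ * _).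
by rewrite mulr_sumr; apply: eq_bigr => c _; rewrite mulrCA.
Qed.

(** Newton's identity: closing the cut cycle of length $k+1$ turns the walks into
traces, and the common factor $n!$ cancels. *)
Lemma ksum_newton n (tf : forall m (x : R), x *+ m.+1 = 0 -> x = 0) :
  s n.+1 *+ n.+1 = \sum_(k < n.+1) s (n - k) * \sum_a walk k a a.
Proof.
have := ksumE n.+1; rewrite -trace_open_ksum.
under eq_bigr do rewrite open_ksumE.
rewrite sumrMnl factS mulrnA => /eqP.
rewrite eq_sym -subr_eq0 -mulrnBl -(prednK (fact_gt0 n)) => /eqP/tf/eqP.
rewrite subr_eq0 => /eqP ->.
by rewrite exchange_big; apply: eq_bigr => k _; rewrite mulr_sumr.
Qed.

End CycleSums.

(** * Traces from coordinate functionals *)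

Section Scalar.
Variables (k : fieldType) (V : vectType k).

Lemma scalar_sum (l : V -> k) (I : finType) (c : I -> k) (v : I -> V) :
  scalar l -> l (\sum_i c i *: v i) = \sum_i c i * l (v i).
Proof.
move=> hl; have l0 : l 0 = 0.
  by have := hl (-1) 0 0; rewrite scaler0 addr0 mulN1r addNr.
have lD u w : l (u + w) = l u + l w by rewrite -{1}[u]scale1r hl mul1r.
rewrite (big_morph l lD l0); apply: eq_bigr => i _.
by have := hl (c i) (v i) 0; rewrite !addr0 l0 addr0.
Qed.

Lemma lfmxE (f : 'End(V)) i j :
  lfmx f i j = coord (vbasis {:V}) j (f (vbasis {:V})`_i).
Proof. by rewrite mxE /= passmx.vecof_delta mxE. Qed.

Lemma coord_vbasis_full (v : V) :
  v = \sum_i coord (vbasis {:V}) i v *: (vbasis {:V})`_i.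
Proof. by rewrite -coord_vbasis ?memvf. Qed.

(** The identity is the sum of the rank-one maps $e_i \otimes l_i$, so $f$ is the sum
of the maps $f(e_i) \otimes l_i$, of traces $l_i(f(e_i))$. *)
Lemma lftrace_frame (I : finType) (e : I -> V) (l : I -> V -> k)
    (hl : forall i, scalar (l i)) (he : forall v, v = \sum_i l i v *: e i)
    (f : 'End(V)) :
  lftrace f = \sum_i l i (f (e i)).
Proof.
rewrite /lftrace /mxtrace.
transitivity (\sum_a \sum_i coord (vbasis {:V}) a (f (e i)) * l i (vbasis {:V})`_a).
  apply: eq_bigr => a _; rewrite lfmxE {1}[_`_a]he !linear_sum /=.
  by apply: eq_bigr => i _; rewrite !linearZ /= mulrC.
rewrite exchange_big; apply: eq_bigr => i _ /=.
by rewrite [f (e i) in RHS]coord_vbasis_full scalar_sum.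
Qed.
End Scalar.

(** A projector [E] onto [U] transports the data to [U], with the vectors $E e_i$ and
the restricted functionals; these vectors span [U]. *)
Lemma lftrace_restrict_frame (k : fieldType) (V : vectType k) (U : {vspace V})
    (I : finType) (e : I -> V) (l : I -> V -> k)
    (hl : forall i, scalar (l i)) (he : forall v, v = \sum_i l i v *: e i)
    (E : 'End(V)) (EU : forall v, E v \in U) (Eid : forall u, u \in U -> E u = u)
    (f : 'End(V)) (fU : forall i, f (E (e i)) \in U) :
  lftrace (lfrestrict U f) = \sum_i l i (f (E (e i))).
Proof.
rewrite (lftrace_frame (e := fun i => vsproj U (E (e i)))
   (l := fun i u => l i (vsval u))).
- by apply: eq_bigr => i _; rewrite lfunE /= vsprojK // vsprojK.
- by move=> i a u v; rewrite linearP hl.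
move=> u; apply: val_inj; rewrite /= -[LHS]Eid ?subvsP //.
rewrite [X in E X]he !linear_sum; apply: eq_bigr => i _ /=.
by rewrite !linearZ /= vsprojK.
Qed.

Lemma linear_lfun (k : fieldType) (V W : vectType k) (f : V -> W) :
  linear f -> exists g : 'Hom(V, W), forall v, g v = f v.
Proof.
move=> lin_f.
pose g : {linear V -> W} := HB.pack f (GRing.isLinear.Build k V W *:%R f lin_f).
by exists (linfun g) => v; rewrite lfunE.
Qed.

(** * Coordinates on graded spaces *)

Section Homogeneous.
Variable k : fieldType.
Implicit Types V W : nat -> vectType k.

(** The component in degree [m], which is $0$ unless the element has this degree. It
compares elements whose degrees agree only propositionally, without casts. *)
Definition hcomp V m (x : homog V) : V m := dfwith (fun i => 0 : V i) (tagged x) m.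

Lemma hcompE V m (v : V m) : hcomp m (Homog v) = v.
Proof. exact: dfwith_in. Qed.

Lemma hcomp_out V m (x : homog V) : tag x != m -> hcomp m x = 0.
Proof. exact: dfwith_out. Qed.

Lemma hcomp_app V W (F : gr_hom V W) m (x : homog V) :
  hcomp m (gr_app F x) = F m (hcomp m x).
Proof.
have [<-|xm] := eqVneq (tag x) m; last by rewrite !hcomp_out ?linear0.
by case: x => i a; rewrite !hcompE.
Qed.

(** A finite family of homogeneous elements with coordinate functionals. The
functionals take homogeneous elements of any degree and vanish off the degree of
the corresponding element, so that sums need not be restricted by degree. *)
Record gr_frame V (I : finType) (e : I -> homog V) (l : I -> homog V -> k) : Prop :=
  GrFrame {
  frame_scalar : forall i m, scalar (fun v : V m => l i (Homog v));
  frame_deg : forall i x, tag x != tag (e i) -> l i x = 0;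
  frameE : forall m (v : V m), v = \sum_i l i (Homog v) *: hcomp m (e i)
}.

Lemma frame_reindex V (I J : finType) (e : I -> homog V) l (h : J -> I) :
  bijective h -> gr_frame e l -> gr_frame (e \o h) (l \o h).
Proof.
move=> bij_h [ls ld le]; split=> [j m|j x|m v]; [exact: ls|exact: ld|].
by rewrite {1}[v]le (reindex h) //; apply: onW_bij.
Qed.

Definition hscale V (a : k) (x : homog V) : homog V := Homog (a *: tagged x).

Lemma hscale1 V (x : homog V) : hscale 1 x = x.
Proof. by case: x => i v; rewrite /hscale scale1r. Qed.

Lemma hscaleA V a b (x : homog V) : hscale a (hscale b x) = hscale (a * b) x.
Proof. by rewrite /hscale /= scalerA. Qed.

Lemma gr_app_hscale V W (F : gr_hom V W) b x :
  gr_app F (hscale b x) = hscale b (gr_app F x).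
Proof. by rewrite /gr_app /= linearZ. Qed.

Lemma hcomp_linear V m i : linear (fun v : V m => hcomp i (Homog v)).
Proof.
move=> a u v; have [mi|mi] := eqVneq m i; last by rewrite !hcomp_out // scaler0 addr0.
by case: _ / mi; rewrite !hcompE.
Qed.

Lemma Homog_hcomp V (x : homog V) : Homog (hcomp (tag x) x) = x.
Proof. by case: x => i v; rewrite hcompE. Qed.

Lemma frame_inj V (I : finType) (e : I -> homog V) l (x y : homog V) :
  gr_frame e l -> tag x = tag y -> (forall i, l i x = l i y) -> x = y.
Proof.
case: x y => [i u] [j v] [ls ld le] /= ij; case: _ / ij v => v uv.
by congr (Homog _); rewrite [u]le [v]le; apply: eq_bigr => q _; rewrite uv.
Qed.

(** The sum lives in the degree of [a]; the terms whose component in this degree is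
lost have coefficient $0$ anyway. *)
Lemma frame_expand V W (I J : finType) (e : I -> homog V) l (e' : J -> homog W) l'
    (w : I -> homog W) (a : homog V) j :
    gr_frame e l -> gr_frame e' l' -> (forall i, tag (w i) = tag (e i)) ->
  l' j (Homog (\sum_i l i a *: hcomp (tag a) (w i))) = \sum_i l i a * l' j (w i).
Proof.
move=> [_ ld _] [ls' _ _] we; rewrite (scalar_sum _ _ (ls' j (tag a))).
apply: eq_bigr => i _; have [ai|ai] := eqVneq (tag a) (tag (e i)).
  by rewrite ai -we Homog_hcomp.
by rewrite ld ?mul0r.
Qed.

Lemma frame_app V (I : finType) (e : I -> homog V) l (F : gr_end V) (a : homog V) j :
  gr_frame e l -> l j (gr_app F a) = \sum_i l i a * l j (gr_app F (e i)).
Proof.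
move=> el; rewrite -(frame_expand (w := fun i => gr_app F (e i)) a j el el) //.
congr (l j _); case: a => m v; rewrite /gr_app; congr (Homog _) => /=.
rewrite {1}[v](frameE el) linear_sum; apply: eq_bigr => i _.
by rewrite linearZ /= -hcomp_app.
Qed.

Lemma frame0 V (I : finType) (e : I -> homog V) l j m :
  gr_frame e l -> l j (Homog (0 : V m)) = 0.
Proof.
move=> [ls _ _]; have := ls j m (-1) 0 0.
by rewrite scaler0 addr0 mulN1r addNr.
Qed.

Lemma frame_hscale V (I : finType) (e : I -> homog V) l j a (x : homog V) :
  gr_frame e l -> l j (hscale a x) = a * l j x.
Proof.
move=> el; case: x => m v; have := frame_scalar el j a v 0.
by rewrite addr0 (frame0 _ _ el) addr0.
Qed.

Lemma basis_frame V N : (forall i, (N <= i)%N -> \dim {:V i} = 0%N) ->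
  gr_frame (fun x : {i : 'I_N & 'I_(\dim {:V i})} =>
             Homog (vbasis {:V (tag x)})`_(tagged x))
           (fun x y => coord (vbasis {:V (tag x)}) (tagged x) (hcomp (tag x) y)).
Proof.
move=> V0; split=> [x m a u v|x y xy|m v].
- by rewrite hcomp_linear linearP.
- by rewrite hcomp_out ?linear0.
rewrite -(sig_big_dep predT (fun=> predT) (fun (i : 'I_N) (j : 'I_(\dim {:V i})) =>
  coord (vbasis {:V i}) j (hcomp i (Homog v)) *: hcomp m (Homog (vbasis {:V i})`_j))) /=.
have [mN|Nm] := ltnP m N.
  rewrite (bigD1 (Ordinal mN)) //= [X in _ = _ + X]big1 ?addr0 => [|i im].
    by rewrite {1}[v]coord_vbasis_full; apply: eq_bigr => j _; rewrite !hcompE.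
  by rewrite big1 // => j _; rewrite [hcomp m _]hcomp_out ?scaler0.
rewrite big1 => [|i _].
  have := memvf v; have /eqP := V0 _ Nm.
  by rewrite dimv_eq0 => /eqP ->; rewrite memv0 => /eqP.
rewrite big1 // => j _; rewrite [hcomp m _]hcomp_out ?scaler0 //=.
by rewrite neq_ltn (leq_trans (ltn_ord i) Nm).
Qed.

(** A splitting of the degree [n] can be assumed to be the canonical splitting of a
sum $i + j$, which is the only one where pure tensors are defined. *)
Lemma bideg_ind (Q : forall n, bideg n -> Prop) :
  (forall i j, Q (i + j)%N (bidegD i j)) -> forall n p, Q n p.
Proof.
move=> QD n [[[i lt_in] [j lt_jn]] /= ij]; have /= ijn := eqP ij.
move: lt_in lt_jn ij; case: _ / ijn => lt_i lt_j ij.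
have := QD i j; congr (Q _ _); apply: val_inj => /=.
by congr (_, _); apply: val_inj.
Qed.

(** The functional $l \otimes l'$ on the summand of bidegree [p]. *)
Definition contract V W (l : homog V -> k) (l' : homog W -> k) n (p : bideg n)
    (A : tens_piece V W p) : k :=
  \sum_r \sum_s A r s * (l (Homog (vbasis {:V (val p).1})`_r) *
                         l' (Homog (vbasis {:W (val p).2})`_s)).

Lemma contract_scalar V W l l' n p : scalar (@contract V W l l' n p).
Proof.
move=> a A B; rewrite /contract mulr_sumr -big_split; apply: eq_bigr => r _ /=.
rewrite mulr_sumr -big_split; apply: eq_bigr => s _ /=.
by rewrite !mxE mulrDl -mulrA.
Qed.

Lemma contract0 V W l l' n p : @contract V W l l' n p 0 = 0.
Proof.
by rewrite /contract big1 // => r _; rewrite big1 // => s _; rewrite mxE mul0r.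
Qed.

Lemma contract_gr_ptens V W (l : homog V -> k) (l' : homog W -> k) i j
    (a : V i) (b : W j) :
    (forall m, scalar (fun v : V m => l (Homog v))) ->
    (forall m, scalar (fun v : W m => l' (Homog v))) ->
  \sum_p contract l l' (gr_ptens a b p) = l (Homog a) * l' (Homog b).
Proof.
move=> ls ls'; rewrite (bigD1 (bidegD i j)) //= big1 ?addr0 => [|p pij].
  rewrite ffunE dfwith_in /contract /=.
  rewrite [a in RHS]coord_vbasis_full [b in RHS]coord_vbasis_full.
  rewrite (scalar_sum _ _ (ls i)) (scalar_sum _ _ (ls' j)) mulr_suml.
  apply: eq_bigr => r _; rewrite mulr_sumr; apply: eq_bigr => s _.
  by rewrite !mxE big_ord1 !mxE mulrACA.
by rewrite ffunE dfwith_out 1?eq_sym // contract0.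
Qed.
End Homogeneous.

(** * The Kunneth formula in coordinates *)

Section Kunneth.
Variables (k : fieldType) (C : category) (P : finite_products C).
Variables (H : gr_functor k C) (c : cup_product H).

Lemma pull_app_comp (X Y Z : C) (g : mor Y Z) (f : mor X Y) (x : homog (H Z)) :
  gr_app (pull H (compm g f)) x = gr_app (pull H f) (gr_app (pull H g) x).
Proof. by rewrite /gr_app /= pull_comp lfunE. Qed.

Lemma pull_app_id (X : C) (x : homog (H X)) : gr_app (pull H (Defs.idm X)) x = x.
Proof. by case: x => i a; rewrite /gr_app /= pull_id lfunE. Qed.

Lemma pull_hcup (X Y : C) (f : mor X Y) (x y : homog (H Y)) :
  gr_app (pull H f) (hcup c x y) = hcup c (gr_app (pull H f) x) (gr_app (pull H f) y).
Proof. by rewrite /hcup /gr_app /= pull_cup. Qed.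

(** The product of a nonempty list; there is no unit to serve as the product of the
empty list, and its value $0$ makes this commute with pullbacks all the same. *)
Definition hprod (Y : C) (s : seq (homog (H Y))) : homog (H Y) :=
  if s is x :: s' then foldl (@hcup _ _ _ c Y) x s' else Homog (0 : H Y 0).

Lemma hprod_rcons (Y : C) (s : seq (homog (H Y))) y :
  (0 < size s)%N -> hprod (rcons s y) = hcup c (hprod s) y.
Proof. by case: s => //= x s _; rewrite foldl_rcons. Qed.

Lemma pull_hprod (X Y : C) (f : mor X Y) (s : seq (homog (H Y))) :
  gr_app (pull H f) (hprod s) = hprod (map (gr_app (pull H f)) s).
Proof.
case: s => [|x s]; first by rewrite /gr_app /= linear0.
by rewrite /=; elim: s x => [|y s IHs] x //=; rewrite -pull_hcup IHs.
Qed.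

Lemma tag_hprod (Y : C) (s : seq (homog (H Y))) :
  tag (hprod s) = sumn (map (@tag _ _) s).
Proof.
case: s => [|x s] //=; elim: s x => [|y s IHs] x /=; first by rewrite addn0.
by rewrite IHs /= addnA.
Qed.

Lemma crossE (X : C) n (a : 'I_n.+1 -> homog (H X)) :
  cross P c a = hprod [seq gr_app (pull H (powp P X i)) (a i) | i <- enum 'I_n.+1].
Proof. by rewrite enum_ordSl /= -map_comp /cross /image_mem. Qed.

(** The external product $x \times y = p_X^*(x) \cup p_Y^*(y)$. *)
Definition cross2 (X Y : C) (x : homog (H X)) (y : homog (H Y)) :
    homog (H (prod2 P X Y)) :=
  hcup c (gr_app (pull H (proj1 P X Y)) x) (gr_app (pull H (proj2 P X Y)) y).

(** The functional of index $(i,j)$ is $l_i \otimes l'_j$ read through the Kunneth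
isomorphism. Its value on an external product is known, and the external products
span, so the expansion has to be checked only on them, where it follows from
bilinearity of the cup product. *)
Lemma frame_prod2 (kun : kunneth P c) (X Y : C) (I J : finType)
    (e : I -> homog (H X)) l (e' : J -> homog (H Y)) l' :
  gr_frame e l -> gr_frame e' l' ->
  exists L : I * J -> homog (H (prod2 P X Y)) -> k,
    gr_frame (fun ij => cross2 (e ij.1) (e' ij.2)) L /\
    forall ij x y, L ij (cross2 x y) = l ij.1 x * l' ij.2 y.
Proof.
move=> [ls ld le] [ls' ld' le'].
have [kappa [klin kbij kE]] := kun X Y.
pose L (ij : I * J) (w : homog (H (prod2 P X Y))) :=
  \sum_p contract (l ij.1) (l' ij.2) (kappa (tag w) (tagged w) p).
have LE ij x y : L ij (cross2 x y) = l ij.1 x * l' ij.2 y.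
  case: x y => [i a] [j b]; rewrite /L /= kE.
  exact: (contract_gr_ptens a b (ls _) (ls' _)).
have Ls ij m : scalar (fun v : H (prod2 P X Y) m => L ij (Homog v)).
  move=> a u v; rewrite /L /= mulr_sumr -big_split; apply: eq_bigr => p _ /=.
  by rewrite klin contract_scalar.
exists L; split=> //; split=> // [[i j] x txy | m0 v].
  rewrite /L big1 // => -[[p1 p2] /= p12] _.
  rewrite /contract big1 // => r _; rewrite big1 // => s _ /=.
  have [e1|p1e] := eqVneq (p1 : nat) (tag (e i)); last by rewrite ld ?mul0r ?mulr0.
  have [e2|p2e] := eqVneq (p2 : nat) (tag (e' j)); last by rewrite ld' ?mulr0.
  by case/eqP: txy; rewrite -[LHS](eqP p12) /= e1 e2.
pose good m (v : H (prod2 P X Y) m) :=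
  v = \sum_ij L ij (Homog v) *: hcomp m (cross2 (e ij.1) (e' ij.2)).
have kappa_sum m (K : finType) (b : K -> k) (w : K -> H (prod2 P X Y) m) p :
    kappa m (\sum_i b i *: w i) p = \sum_i b i *: kappa m (w i) p.
  have k0 : kappa m 0 p = 0.
    by have := klin m p (-1) 0 0; rewrite scaler0 addr0 scaleN1r addNr.
  have kD u u' : kappa m (u + u') p = kappa m u p + kappa m u' p.
    by rewrite -{1}[u]scale1r klin scale1r.
  rewrite (big_morph (fun u => kappa m u p) kD k0); apply: eq_bigr => q _.
  by have := klin m p (b q) (w q) 0; rewrite !addr0 k0 addr0.
have kappa_inj m (u u' : H (prod2 P X Y) m) :
    (forall p, kappa m u p = kappa m u' p) -> u = u'.
  by move=> uu'; apply: (bij_inj (kbij m)); apply/ffunP.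
have good_sum m (K : finType) (b : K -> k) (w : K -> H (prod2 P X Y) m) :
    (forall q, good m (w q)) -> good m (\sum_q b q *: w q).
  move=> gw; rewrite /good.
  under [RHS]eq_bigr do rewrite (scalar_sum _ _ (Ls _ _)) scaler_suml.
  rewrite exchange_big; apply: eq_bigr => q _ /=; rewrite {1}[w q]gw scaler_sumr.
  by apply: eq_bigr => ij _; rewrite scalerA.
pose cup2 i j (a : H X i) (b : H Y j) : H (prod2 P X Y) (i + j)%N :=
  cup c _ i j (pull H (proj1 P X Y) i a) (pull H (proj2 P X Y) j b).
have cup2_sum i j (K K' : finType) x (u : K -> H X i) y (v' : K' -> H Y j) :
    cup2 i j (\sum_r x r *: u r) (\sum_s y s *: v' s) =
    \sum_r \sum_s (x r * y s) *: cup2 i j (u r) (v' s).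
  rewrite /cup2 linear_sum linear_sumlz; apply: eq_bigr => r _.
  rewrite linear_sum linear_sumr; apply: eq_bigr => s _.
  by rewrite !linearZ /= linearZl_LR /= scalerA mulrC.
have good_cup i j (a : H X i) (b : H Y j) : good (i + j)%N (cup2 i j a b).
  rewrite /good {1}[a]le {1}[b]le' cup2_sum.
  rewrite -(pair_big predT predT (fun r s => L (r, s) (cross2 (Homog a) (Homog b))
    *: hcomp (i + j)%N (cross2 (e r) (e' s)))) /=.
  apply: eq_bigr => r _; apply: eq_bigr => s _; rewrite LE /=.
  have [ri|ri] := eqVneq i (tag (e r)); last by rewrite ld ?mul0r ?scale0r.
  have [sj|sj] := eqVneq j (tag (e' s)); last by rewrite ld' ?mulr0 ?scale0r.
  congr (_ *: _); case: (e r) (e' s) ri sj => [i' u] [j' v'] /= ii jj.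
  by case: _ / ii u; case: _ / jj v' => {}v' u; rewrite /cross2 /hcup /cup2 !hcompE.
(* Injectivity of the Kunneth map, one bidegree at a time. *)
have good_single m (p : bideg m) (u : H (prod2 P X Y) m) :
    (forall q, q != p -> kappa m u q = 0) -> good m u.
  elim/bideg_ind: m / p u => i j u up.
  pose A : 'M[k]_(\dim {:H X i}, \dim {:H Y j}) := kappa _ u (bidegD i j).
  pose w (rs : 'I_(\dim {:H X i}) * 'I_(\dim {:H Y j})) : H (prod2 P X Y) (i + j)%N :=
    cup2 i j (vbasis {:H X i})`_rs.1 (vbasis {:H Y j})`_rs.2.
  have -> : u = \sum_rs A rs.1 rs.2 *: w rs.
    apply: kappa_inj => q; rewrite kappa_sum.
    have [->|qij] := eqVneq q (bidegD i j); last first.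
      rewrite up // big1 // => rs _; rewrite /w /cup2 kE ffunE dfwith_out ?scaler0 //.
      by rewrite eq_sym.
    rewrite -[LHS]/A [LHS]matrix_sum_delta pair_big; apply: eq_bigr => -[r s] _ /=.
    rewrite /w /cup2 kE ffunE dfwith_in /ptens; congr (_ *: _).
    by rewrite !passmx.rVofE ?vbasisP // trmx_delta mul_delta_mx.
  by apply: good_sum => q; apply: good_cup.
(* Surjectivity of the Kunneth map splits v into its bidegrees. *)
have [kinv kK Kk] := kbij m0.
pose single (p : bideg m0) : gr_tens (H X) (H Y) m0 :=
  finfun (dfwith (fun q => 0 : tens_piece (H X) (H Y) q) (kappa m0 v p)).
have -> : v = \sum_p 1 *: kinv (single p).
  apply: kappa_inj => q; rewrite kappa_sum (bigD1 q) //= big1 => [|p pq].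
    by rewrite addr0 scale1r Kk ffunE dfwith_in.
  by rewrite Kk ffunE dfwith_out // scaler0.
apply: good_sum => p; apply: (good_single _ p) => q qp.
by rewrite Kk ffunE dfwith_out // eq_sym.
Qed.

Lemma frame_iso (Y Z : C) (u : mor Y Z) (v : mor Z Y) (I : finType)
    (e : I -> homog (H Z)) l :
  compm v u = Defs.idm Y -> gr_frame e l ->
  gr_frame (fun i => gr_app (pull H u) (e i)) (fun i y => l i (gr_app (pull H v) y)).
Proof.
move=> vu [ls ld le]; split=> [i m a x y|i x|m y].
- by rewrite /gr_app /= linearP ls.
- exact: (ld i (gr_app (pull H v) x)).
have yE : y = pull H u m (pull H v m y).
  by have /lfunP/(_ y) := pull_comp H v u m; rewrite vu pull_id !lfunE.
rewrite {1}yE {1}[pull H v m y]le linear_sum.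
by apply: eq_bigr => i _; rewrite linearZ /= hcomp_app.
Qed.

Section Power.
Variable X : C.

Lemma powo_ext n (Z : C) (f g : mor Z (powo P X n)) :
  (forall i, compm (powp P X i) f = compm (powp P X i) g) -> f = g.
Proof. by move=> fg; rewrite (tupm_uniq fg); apply/esym/tupm_uniq. Qed.

Lemma prod2_ext (Y Y' Z : C) (f g : mor Z (prod2 P Y Y')) :
    compm (proj1 P Y Y') f = compm (proj1 P Y Y') g ->
    compm (proj2 P Y Y') f = compm (proj2 P Y Y') g -> f = g.
Proof.
move=> fg1 fg2.
have fg b : compm (proj P (fun b : bool => if b then Y else Y') b) f =
            compm (proj P (fun b : bool => if b then Y else Y') b) g.
  by case: b.
by rewrite (tupm_uniq fg); apply/esym/tupm_uniq.
Qed.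

Definition pair_fam (Y Y' Z : C) (f : mor Z Y) (g : mor Z Y') (b : bool) :
    mor Z (if b then Y else Y') :=
  if b as b0 return mor Z (if b0 then Y else Y') then f else g.

Definition pair_mor (Y Y' Z : C) (f : mor Z Y) (g : mor Z Y') : mor Z (prod2 P Y Y') :=
  tupm P (pair_fam f g).

Lemma proj1_pair (Y Y' Z : C) (f : mor Z Y) (g : mor Z Y') :
  compm (proj1 P Y Y') (pair_mor f g) = f.
Proof. exact: (proj_tupm P (pair_fam f g) true). Qed.

Lemma proj2_pair (Y Y' Z : C) (f : mor Z Y) (g : mor Z Y') :
  compm (proj2 P Y Y') (pair_mor f g) = g.
Proof. exact: (proj_tupm P (pair_fam f g) false). Qed.

Definition pow_init n : mor (powo P X n.+1) (powo P X n) :=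
  tupm P (fun i => powp P X (lift ord_max i)).

(** The isomorphism $X^{n+1} \simeq X^n \times X$ and its inverse. *)
Definition pow_split n : mor (powo P X n.+1) (prod2 P (powo P X n) X) :=
  pair_mor (pow_init n) (powp P X ord_max).

Definition pow_snoc n : mor (prod2 P (powo P X n) X) (powo P X n.+1) :=
  tupm P (fun i => if unlift ord_max i is Some j
    then compm (powp P X j) (proj1 P (powo P X n) X) else proj2 P (powo P X n) X).

Lemma pow_splitK n : compm (pow_snoc n) (pow_split n) = Defs.idm _.
Proof.
apply: powo_ext => i; rewrite compm1 Defs.compA proj_tupm.
case: unliftP => [j|] ->; last by rewrite proj2_pair.
by rewrite -Defs.compA proj1_pair proj_tupm.
Qed.

Lemma pow_snocK n : compm (pow_split n) (pow_snoc n) = Defs.idm _.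
Proof.
apply: prod2_ext; rewrite compm1 Defs.compA ?proj1_pair ?proj2_pair.
  by apply: powo_ext => i; rewrite Defs.compA !proj_tupm liftK.
by rewrite proj_tupm unlift_none.
Qed.

Lemma tag_cross n (a : 'I_n.+1 -> homog (H X)) :
  tag (cross P c a) = \sum_i tag (a i).
Proof. by rewrite crossE tag_hprod -map_comp sumnE big_map big_enum. Qed.

Lemma pull_cross n (Y : C) (u : mor Y (powo P X n.+1)) (a : 'I_n.+1 -> homog (H X)) :
  gr_app (pull H u) (cross P c a) =
  hprod [seq gr_app (pull H (compm (powp P X i) u)) (a i) | i <- enum 'I_n.+1].
Proof.
rewrite crossE pull_hprod -map_comp; congr hprod.
by apply: eq_map => i /=; rewrite pull_app_comp.
Qed.

Lemma widen_lift_max n (i : 'I_n) : widen_ord (leqnSn n) i = lift ord_max i.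
Proof. by apply: ord_inj; rewrite lift_max. Qed.

Lemma cross_recr n (a : 'I_n.+2 -> homog (H X)) :
  cross P c a = gr_app (pull H (pow_split n.+1))
    (cross2 (cross P c (a \o lift ord_max)) (a ord_max)).
Proof.
rewrite /cross2 pull_hcup -!pull_app_comp proj1_pair proj2_pair.
rewrite pull_cross crossE enum_ordSr map_rcons hprod_rcons.
  rewrite -map_comp; congr (hcup _ (hprod _) _).
  apply: eq_map => i; rewrite /= proj_tupm.
  by rewrite widen_lift_max.
by rewrite enum_ordSl.
Qed.

(** Induction along $X^{n+1} \simeq X^n \times X$, under which the cross product of
$n+1$ factors is the external product of the first $n$ with the last one. *)
Lemma frame_pow (kun : kunneth P c) (I : finType) (e : I -> homog (H X)) l n :
  gr_frame e l ->
  exists L : {ffun 'I_n.+1 -> I} -> homog (H (powo P X n.+1)) -> k,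
    gr_frame (fun f : {ffun 'I_n.+1 -> I} => cross P c (e \o f)) L /\
    forall (f : {ffun 'I_n.+1 -> I}) a, L f (cross P c a) = \prod_i l (f i) (a i).
Proof.
move=> el; elim: n => [|n [L [eL LE]]].
  have vu : compm (tupm P (fun=> Defs.idm X)) (powp P X ord0) = Defs.idm (powo P X 1).
    apply: powo_ext => i; rewrite compm1 Defs.compA proj_tupm comp1m.
    by rewrite (ord1 i).
  have uv : compm (powp P X (ord0 : 'I_1)) (tupm P (fun=> Defs.idm X)) = Defs.idm X.
    exact: proj_tupm.
  have cross1 a : cross P c a = gr_app (pull H (powp P X (ord0 : 'I_1))) (a ord0).
    by rewrite crossE enum_ordSl enum_ord0.
  pose ev (f : {ffun 'I_1 -> I}) := f ord0.
  have bij_ev : bijective ev.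
    exists (fun x => [ffun=> x]) => [f|x]; last by rewrite /ev ffunE.
    by apply/ffunP => i; rewrite ffunE (ord1 i).
  have elu := frame_reindex bij_ev (frame_iso vu el).
  exists (fun f y => l (f ord0) (gr_app (pull H (tupm P (fun=> Defs.idm X))) y)).
  split.
    case: elu => ls ld le; split=> [//|f x|m v].
      by rewrite cross1; apply: ld.
    by rewrite {1}[v]le; apply: eq_bigr => f _; rewrite cross1.
  by move=> f a; rewrite cross1 -pull_app_comp uv pull_app_id big_ord1.
have [L' [eL' LE']] := frame_prod2 kun eL el.
pose cut (f : {ffun 'I_n.+2 -> I}) : {ffun 'I_n.+1 -> I} * I :=
  ([ffun i => f (lift ord_max i)], f ord_max).
have bij_cut : bijective cut.
  exists (fun p : {ffun 'I_n.+1 -> I} * I =>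
    [ffun i => if unlift ord_max i is Some j then p.1 j else p.2]) => [f|[f x]].
    by apply/ffunP => i; rewrite ffunE; case: unliftP => [j|] -> //=; rewrite ffunE.
  congr (_, _); last by rewrite ffunE unlift_none.
  by apply/ffunP => i; rewrite !ffunE liftK.
have elu := frame_reindex bij_cut (frame_iso (pow_splitK n.+1) eL').
have crossS (f : {ffun 'I_n.+2 -> I}) : cross P c (e \o f) =
    gr_app (pull H (pow_split n.+1)) (cross2 (cross P c (e \o (cut f).1)) (e (cut f).2)).
  rewrite cross_recr; congr (gr_app _ (cross2 (cross _ _ _) _)).
  by apply/funext => i /=; rewrite ffunE.
exists (fun f y => L' (cut f) (gr_app (pull H (pow_snoc n.+1)) y)); split.
  case: elu => ls ld le; split=> [//|f x|m v].
    by rewrite crossS; apply: ld.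
  by rewrite {1}[v]le; apply: eq_bigr => f _; rewrite crossS.
move=> f a; rewrite cross_recr -pull_app_comp pow_snocK pull_app_id LE' LE /=.
rewrite [RHS]big_ord_recr /=; congr (_ * _); apply: eq_bigr => i _; rewrite ffunE /=.
by rewrite widen_lift_max.
Qed.
End Power.
End Kunneth.

(** * Koszul signs *)

Lemma enum_ord_split n (j : 'I_n.+1) : exists W R : seq 'I_n.+1,
  enum 'I_n.+1 = W ++ j :: R /\ map (lift j) (enum 'I_n) = W ++ R.
Proof.
exists (take j (enum 'I_n.+1)), (drop j.+1 (enum 'I_n.+1)).
have lt_j : (j < size (enum 'I_n.+1))%N by rewrite size_enum_ord.
split; first by rewrite -{1}(cat_take_drop j (enum _)) (drop_nth j lt_j) nth_ord_enum.
apply: (inj_map val_inj); rewrite map_cat map_take map_drop val_enum_ord.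
rewrite -map_comp (@eq_map _ _ _ (bump j \o val)) // map_comp val_enum_ord.
have jn : (j <= n)%N by rewrite -ltnS.
have -> : iota 0 n = iota 0 j ++ iota j (n - j) by rewrite -{1}(subnKC jn) iotaD.
have -> : iota 0 n.+1 = iota 0 j ++ iota j (n - j).+1 by rewrite -iotaD addnS subnKC.
rewrite map_cat take_size_cat ?size_iota // drop_cat size_iota ltnNge leqnSn /=.
rewrite subSn // subnn /= drop0; congr (_ ++ _).
  rewrite -[RHS]map_id; apply/eq_in_map => i; rewrite mem_iota /bump => /andP[_ ij].
  by rewrite leqNgt ij.
rewrite -[j.+1]add1n iotaDl; apply/eq_in_map => i; rewrite mem_iota /bump.
by case/andP => -> _.
Qed.

Section Signs.
Variables (k : fieldType) (C : category) (P : finite_products C).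
Variables (H : gr_functor k C) (c : cup_product H).

Variable Y : C.
Implicit Types (x y z : homog (H Y)) (s r w : seq (homog (H Y))).

Lemma hcup_scalel a x y : hcup c (hscale a x) y = hscale a (hcup c x y).
Proof. by rewrite /hcup /hscale /= linearZl_LR. Qed.

Lemma hcup_scaler a x y : hcup c x (hscale a y) = hscale a (hcup c x y).
Proof. by rewrite /hcup /hscale /= linearZr_LR. Qed.

Lemma hcupC x y : hcup c x y = hscale ((-1) ^+ (tag x * tag y)) (hcup c y x).
Proof. exact: cupC. Qed.

Lemma hcupA x y z : hcup c (hcup c x y) z = hcup c x (hcup c y z).
Proof. exact: cupA. Qed.

Lemma foldl_hcup_scale a x s :
  foldl (@hcup _ _ _ c Y) (hscale a x) s = hscale a (foldl (@hcup _ _ _ c Y) x s).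
Proof. by elim: s x => //= y s IHs x; rewrite hcup_scalel IHs. Qed.

Lemma hprod_cons x s : (0 < size s)%N -> hprod c (x :: s) = hcup c x (hprod c s).
Proof.
case: s => //= y s _; elim: s y => //= z s IHs y.
by rewrite hcupA IHs.
Qed.

(** Moving [z] to the front past [w] costs the sign of swapping [z] with the product
of [w], by graded commutativity and associativity. *)
Lemma hprod_front w z r :
  hprod c (w ++ z :: r) =
  hscale ((-1) ^+ (tag z * sumn (map (@tag _ _) w))) (hprod c (z :: w ++ r)).
Proof.
case: w => [|x w]; first by rewrite muln0 expr0 hscale1.
rewrite [hprod c _]/= [in RHS]/= !foldl_cat /= -[foldl _ x w]/(hprod c (x :: w)).
rewrite hcupC foldl_hcup_scale tag_hprod mulnC; congr (hscale _ _).
by rewrite -hprod_cons.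
Qed.

(** Moving [z] to the front and then [x] back to the place that [z] has left. *)
Lemma hprod_swap x w z r :
  hprod c (x :: w ++ z :: r) =
  hscale ((-1) ^+ (tag z * (tag x + sumn (map (@tag _ _) w)) +
                   tag x * sumn (map (@tag _ _) w)))
    (hprod c (z :: w ++ x :: r)).
Proof.
rewrite -cat_cons hprod_front exprD -hscaleA; congr (hscale _ _).
rewrite (hprod_cons z) // (hprod_cons z) ?size_cat ?addnS // hprod_front.
rewrite hcup_scaler hscaleA.
by rewrite -expr2 sqrr_sign hscale1.
Qed.
Lemma sign_sumn_tag (T : Type) (y : T -> homog (H Y)) (d : T -> bool) (W : seq T) :
    (forall i, odd (tag (y i)) = d i) ->
  odd (sumn (map (@tag _ _) (map y W))) = odd (sumn (map (nat_of_bool \o d) W)).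
Proof. by move=> yd; elim: W => //= i W IHW; rewrite !oddD IHW yd; case: (d i). Qed.
End Signs.

Section PermSign.
Variables (k : fieldType) (C : category) (P : finite_products C).
Variables (H : gr_functor k C) (c : cup_product H).

(** Permuting the factors changes a product by a sign that depends only on the
parities [d] of the degrees: this uniformity is what makes $\phi_{X^n}$ commute
with the action. The sign is identified when [d] is invariant under [g], the case
in which $g$ contributes to the trace. The induction follows [insert_perm]: a swap
of the first factor with the $j$-th, and a permutation fixing the $j$-th factor,
which is moved to the front before and after the others are permuted. *)
Lemma hprod_perm n (g : 'S_n.+1) (d : 'I_n.+1 -> bool) :
  exists b : bool,
    (forall (Y : C) (y : 'I_n.+1 -> homog (H Y)), (forall i, odd (tag (y i)) = d i) ->
      hprod c [seq y (g i) | i <- enum 'I_n.+1] =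
      hscale ((-1) ^+ b) (hprod c [seq y i | i <- enum 'I_n.+1])) /\
    (d \o g =1 d -> b = ksign g d).
Proof.
elim: n g d => [|n IHn] g d.
  exists false; split=> [Y y _|_].
    by rewrite enum_ordSl enum_ord0 /= hscale1 (ord1 (g ord0)).
  rewrite -(skip_permK g) ksign_insert (ord1 (g ord0)) eqxx.
  by rewrite /ksign.
rewrite -(skip_permK g); move: (g ord0) (skip_perm g) => {g} j s.
have [b3 [IHy IHd]] := IHn s (d \o lift j).
set g := insert_perm j s; pose h := lift_perm j j s.
have [W [R [eWR lWR]]] := enum_ord_split j.
pose par (d : 'I_n.+2 -> bool) (W : seq 'I_n.+2) :=
  odd (sumn (map (nat_of_bool \o d) W)).
pose dz := d \o h.
(* The sign of the swap, and below the signs of moving the j-th factor to the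
   front in the permuted and in the original product; the last two cancel when
   the degrees are invariant. *)
pose b1 := (j != ord0) && ((dz ord0 && (dz j (+) par dz (behead W))) (+)
   dz j && par dz (behead W)).
exists (b1 (+) (dz j && par dz W) (+) b3 (+) (d j && par d W)); split=> [Y y yd | dg].
  pose z := y \o h.
  have zd i : odd (tag (z i)) = dz i by rewrite /z /= yd.
  have swap : hprod c [seq y (g i) | i <- enum 'I_n.+2] =
      hscale ((-1) ^+ b1) (hprod c [seq z i | i <- enum 'I_n.+2]).
    have gE i : g i = h (tperm ord0 j i) by rewrite permM.
    rewrite /b1; have [j0|j0] := eqVneq j ord0.
      by rewrite hscale1; congr hprod; apply: eq_map => i; rewrite gE j0 tperm1 perm1.
    have := enum_uniq 'I_n.+2; rewrite eWR /par.
    case: W eWR {lWR b1} => [|x W] eWR.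
      by case/eqP: j0; move: eWR; rewrite enum_ordSl => -[].
    have -> : x = ord0 by move: eWR; rewrite enum_ordSl => -[].
    move=> U; have [W0 R0 jW jR] :
        [/\ ord0 \notin W, ord0 \notin R, j \notin W & j \notin R].
      move: U; rewrite /= mem_cat inE cat_uniq /= !negb_or -!andbA.
      by case/and5P=> -> _ -> _ /and4P[-> _ -> _].
    have out V : ord0 \notin V -> j \notin V ->
        [seq y (g i) | i <- V] = [seq z i | i <- V].
      move=> V0 jV; apply/eq_in_map => i iV; rewrite gE tpermD //.
        by apply: contraNneq V0 => ->.
      by apply: contraNneq jV => ->.
    have -> : [seq y (g i) | i <- ord0 :: W ++ j :: R] =
        z j :: [seq z i | i <- W] ++ z ord0 :: [seq z i | i <- R].
      by rewrite /= map_cat /= !out // !gE tpermL tpermR.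
    rewrite hprod_swap [in RHS]map_cons [in RHS]map_cat [in RHS]map_cons.
    congr (hscale _ _).
    rewrite -signr_odd oddD !oddM oddD !zd (sign_sumn_tag _ zd).
    by [].
  have front (y' : 'I_n.+2 -> homog (H Y)) d' : (forall i, odd (tag (y' i)) = d' i) ->
      hprod c [seq y' i | i <- enum 'I_n.+2] =
      hscale ((-1) ^+ (d' j && par d' W))
       (hcup c (y' j) (hprod c [seq y' (lift j i) | i <- enum 'I_n.+1])).
    move=> yd'; rewrite eWR map_cat /= hprod_front; congr (hscale _ _).
      by rewrite -signr_odd oddM (sign_sumn_tag _ yd') yd'.
    rewrite -map_cat -lWR -map_comp hprod_cons // size_map.
    by rewrite enum_ordSl.
  rewrite swap (front z dz zd) (front y d yd).
  have -> : z j = y j by rewrite /z /= lift_perm_id.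
  have -> : [seq z (lift j i) | i <- enum 'I_n.+1] =
            [seq (y \o lift j) (s i) | i <- enum 'I_n.+1].
    by apply: eq_map => i; rewrite /z /= lift_perm_lift.
  rewrite IHy => [|i]; last by rewrite /= yd.
  rewrite hcup_scaler !hscaleA -!signr_addb; congr (hscale (_ ^+ nat_of_bool _) _).
  by rewrite -!addbA addbb addbF.
have d0j : d ord0 = d j by rewrite -(dg ord0) /= insert_perm0.
have dzE : dz =1 d.
  have dt i : d (tperm ord0 j i) = d i by case: tpermP => // ->.
  by move=> i; rewrite -(dt i) -[RHS]dg /= permM tpermK.
have par_dz W' : par dz W' = par d W'.
  by congr (odd (sumn _)); apply: eq_map => i; rewrite /= dzE.
rewrite ksign_insert IHd => [|i]; last first.
  by rewrite /= -[RHS]dzE /dz /= /h lift_perm_lift.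
rewrite /b1 !par_dz !dzE -d0j.
by case: (j != ord0) (d ord0) (par d W) (par d (behead W)) (ksign _ _)
  => [] [] [] [] [].
Qed.
End PermSign.

(** * The trace on the invariants *)

Section Lefschetz.
Variables (k : fieldType) (char0 : [pchar k] =i pred0).
Variables (C : category) (P : finite_products C).
Variables (H : gr_functor k C) (c : cup_product H) (kun : kunneth P c).
Variables (X : C) (phi : gr_end (H X)).
Variables (I : finType) (e : I -> homog (H X)) (l : I -> homog (H X) -> k).
Hypothesis el : gr_frame e l.

Let A x y := l y (gr_app phi (e x)).

(** The induced endomorphism exists: send each $e_h$ to the cross product of the
$\phi(e_{h(j)})$ and extend by coordinates. That it has the required value on all
cross products is checked in coordinates, where both sides become a product over
the factors of sums over the basis. *)
Lemma pow_end_induces n : induces c phi (pow_end P c phi n).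
Proof.
rewrite /pow_end; apply: xgetPex.
have [L [eL LE]] := frame_pow kun n el.
have PhiP m : exists g : 'End(H (powo P X n.+1) m), forall v,
    g v = \sum_f L f (Homog v) *: hcomp m (cross P c (gr_app phi \o (e \o f))).
  apply: linear_lfun => a u v.
  rewrite scaler_sumr -big_split; apply: eq_bigr => f _ /=.
  by rewrite (frame_scalar eL) scalerDl scalerA.
exists (fun m => sval (cid (PhiP m))) => a.
set Phi := fun m => _.
have PhiE m v : Phi m v =
    \sum_f L f (Homog v) *: hcomp m (cross P c (gr_app phi \o (e \o f))).
  exact: (svalP (cid (PhiP m))).
apply: (frame_inj eL) => [|f].
  by rewrite /= -[LHS]/(tag (cross P c a)) !tag_cross.
transitivity (\sum_h L h (cross P c a) * L f (cross P c (gr_app phi \o (e \o h)))).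
  rewrite -(frame_expand
    (w := fun h : {ffun 'I_n.+1 -> I} => cross P c (gr_app phi \o (e \o h)))
    (cross P c a) f eL eL) => [|h]; last by rewrite !tag_cross.
  congr (L f _); rewrite /gr_app; congr (Homog _); rewrite PhiE.
  by case: (cross P c a).
rewrite LE /=; under [RHS]eq_bigr do rewrite (frame_app phi _ _ el).
rewrite bigA_distr_bigA; apply: eq_bigr => h _.
by rewrite !LE big_split.
Qed.

Lemma pull_permm_cross n (g : 'S_n.+1) (d : 'I_n.+1 -> bool) :
  exists b : bool,
    (forall a : 'I_n.+1 -> homog (H X), (forall i, odd (tag (a i)) = d i) ->
      gr_app (pull H (permm P X g)) (cross P c a) =
      hscale ((-1) ^+ b) (cross P c (fun i => a ((g^-1)%g i)))) /\
    ((forall i, d (g i) = d i) -> b = ksign g d).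
Proof.
have [b [bE bd]] := hprod_perm c g (fun i => d ((g^-1)%g i)).
exists b; split=> [a ad|dg].
  rewrite pull_cross crossE -bE => [|i]; last by rewrite /= ad.
  by congr hprod; apply: eq_map => i; rewrite proj_tupm permK.
rewrite bd => [|i /=]; last by rewrite permK -{1}[i](permKV g) dg.
by apply: eq_ksign => i; rewrite -{2}[i](permKV g) dg.
Qed.

Lemma pull_permm_comp n (g h : 'S_n) m v :
  pull H (permm P X h) m (pull H (permm P X g) m v) = pull H (permm P X (g * h)%g) m v.
Proof.
have -> : permm P X (g * h)%g = compm (permm P X g) (permm P X h).
  by apply: powo_ext => i; rewrite Defs.compA !proj_tupm permM.
by rewrite pull_comp lfunE.
Qed.

Definition symmetrizer n m : 'End(H (powo P X n) m) :=
  (n`!%:R)^-1 *: \sum_(g : 'S_n) pull H (permm P X g) m.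

Lemma fact_neq0 n : n`!%:R != 0 :> k.
Proof. by rewrite (iffLR (pcharf0P k) char0) -lt0n fact_gt0. Qed.

Lemma symmetrizerE n m v :
  symmetrizer n m v = (n`!%:R)^-1 *: \sum_(g : 'S_n) pull H (permm P X g) m v.
Proof. by rewrite /symmetrizer scale_lfunE sum_lfunE. Qed.

Lemma invariantsP n m (v : H (powo P X n) m) :
  reflect (forall g, pull H (permm P X g) m v = v) (v \in invariants P H X n m).
Proof.
rewrite /invariants memvE; apply: (iffP subv_bigcapP) => vg g.
  by apply/fixedSpaceP; rewrite memvE; apply: vg.
by move=> _; rewrite -memvE; apply/fixedSpaceP.
Qed.

Lemma symmetrizer_inv n m v : symmetrizer n m v \in invariants P H X n m.
Proof.
apply/invariantsP => h; rewrite symmetrizerE linearZ linear_sum /=; congr (_ *: _).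
under eq_bigr do rewrite pull_permm_comp.
by rewrite [RHS](reindex_inj (mulIg h)).
Qed.

Lemma symmetrizer_id n m v : v \in invariants P H X n m -> symmetrizer n m v = v.
Proof.
move=> /invariantsP vg; rewrite symmetrizerE.
under eq_bigr do rewrite vg.
rewrite sumr_const cardT -cardE card_Sn -scaler_nat scalerA mulVf ?scale1r //.
exact: fact_neq0.
Qed.

(** The trace of $\phi_{X^n} E$ in the coordinates of [frame_pow], before division by
the number of permutations. *)
Lemma lftrace_pow_end n m :
  lftrace (pow_end_inv P c phi n m) *+ n.+1`! =
  \sum_(g : 'S_n.+1) \sum_(f : {ffun 'I_n.+1 -> I} | (\sum_i tag (e (f i)))%N == m)
    (-1) ^+ ksign g (fun i => odd (tag (e (f i)))) * \prod_i A (f i) (f (g i)).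
Proof.
have [L [eL LE]] := frame_pow kun n el.
set Phi := pow_end P c phi n.
have PhiE a : gr_app Phi (cross P c a) = cross P c (gr_app phi \o a).
  exact: pow_end_induces.
have comm g a : gr_app Phi (gr_app (pull H (permm P X g)) (cross P c a)) =
    gr_app (pull H (permm P X g)) (cross P c (gr_app phi \o a)).
  have [b [bE _]] := pull_permm_cross g (fun i => odd (tag (a i))).
  by rewrite !bE // gr_app_hscale PhiE.
have EPhi f : Phi m (symmetrizer n.+1 m (hcomp m (cross P c (e \o f)))) =
    symmetrizer n.+1 m (hcomp m (cross P c (gr_app phi \o (e \o f)))).
  rewrite !symmetrizerE linearZ linear_sum /=; congr (_ *: _); apply: eq_bigr => g _.
  by rewrite -!hcomp_app comm.
rewrite /pow_end_inv (lftrace_restrict_frame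
   (e := fun f : {ffun 'I_n.+1 -> I} => hcomp m (cross P c (e \o f)))
   (l := fun f v => L f (Homog v)) _ (@frameE _ _ _ _ _ eL m) (@symmetrizer_inv n.+1 m)
   (@symmetrizer_id n.+1 m)).
- have Lsym f v : L f (Homog (symmetrizer n.+1 m v)) *+ n.+1`! =
      \sum_(g : 'S_n.+1) L f (Homog (pull H (permm P X g) m v)).
    rewrite symmetrizerE scaler_sumr (scalar_sum _ _ (frame_scalar eL f (m := m))).
    by rewrite -mulr_sumr -[LHS]mulr_natl mulrA mulfV ?mul1r // fact_neq0.
  rewrite -sumrMnl; under eq_bigr do rewrite EPhi Lsym.
  rewrite exchange_big; apply: eq_bigr => g _ /=.
  rewrite [RHS]big_mkcond; apply: eq_bigr => f _; rewrite -hcomp_app.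
  have [<-|fm] := eqVneq (\sum_i tag (e (f i)))%N m; last first.
    by rewrite hcomp_out ?(frame0 _ _ eL) //= tag_cross.
  have [b [bE bg]] := pull_permm_cross g (fun i => odd (tag (e (f i)))).
  rewrite -[in LHS](tag_cross P c (gr_app phi \o (e \o f))).
  rewrite (Homog_hcomp (gr_app (pull H (permm P X g))
                               (cross P c (gr_app phi \o (e \o f))))).
  rewrite bE // (frame_hscale _ _ _ eL) LE.
  have -> : \prod_i l (f i) ((gr_app phi \o (e \o f)) ((g^-1)%g i)) =
      \prod_i A (f i) (f (g i)).
    by rewrite (reindex_inj (@perm_inj _ g)); apply: eq_bigr => i _; rewrite permK.
  (* If the degrees of f are not invariant under g, both products vanish. *)
  have [/forallP fg|/forallPn[i fgi]] :=
    boolP [forall i, tag (e (f (g i))) == tag (e (f i))].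
    by rewrite bg // => i; rewrite (eqP (fg i)).
  by rewrite (bigD1 i) //= /A (frame_deg el) ?mul0r ?mulr0 //= eq_sym //.
- by move=> f; exact: (frame_scalar eL).
by move=> f; rewrite EPhi symmetrizer_inv.
Qed.
End Lefschetz.

(** * The generating function *)

Lemma sum_alternate (V : zmodType) (F : nat -> V) (sg : nat -> V -> V) d :
    (forall i v, sg (2 * i)%N v = v) -> (forall i v, sg (2 * i + 1)%N v = - v) ->
  \sum_(i < (2 * d).+1) sg i (F i) =
  \sum_(i < d.+1) F (2 * i)%N - \sum_(i < d) F (2 * i + 1)%N.
Proof.
move=> sg0 sg1; elim: d => [|d IHd].
  by rewrite !big_ord1 big_ord0 subr0 -[RHS](sg0 0%N).
rewrite [in LHS]mulnS !addSn add0n 2!big_ord_recr IHd /=.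
rewrite [in RHS]big_ord_recr [X in _ = _ - X]big_ord_recr /=.
have -> : (2 * d).+1 = (2 * d + 1)%N by rewrite addn1.
have -> : (2 * d + 1).+1 = (2 * d.+1)%N by rewrite mulnS addn1.
by rewrite sg0 sg1 opprD [RHS]addrACA -[LHS]addrA [- _ + _]addrC.
Qed.

(** The partial sums of the dimensions are bounded, so their maximum is attained, and
from then on they stay constant. *)
Lemma gr_findim_bound (k : fieldType) (V : nat -> vectType k) :
  gr_findim V -> exists N, forall i, (N <= i)%N -> \dim {:V i} = 0%N.
Proof.
case=> b Vb; pose S m := \sum_(i < m) \dim {:V i}.
pose hit q := `[< exists m, S m = q >].
have ex_hit : exists q, hit q by exists (S 0); apply/asboolP; exists 0.
have hit_b q : hit q -> (q <= b)%N by move/asboolP => [m <-]; apply: Vb.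
have [q /asboolP[N SN] maxN] := ex_maxnP ex_hit hit_b.
exists N => i Ni; have := maxN (S i.+1).
rewrite /hit => /(_ (asboolT (ex_intro _ i.+1 erefl))).
have leS m m' : (m <= m')%N -> (S m <= S m')%N.
  move=> mm'; rewrite /S (big_ord_widen _ (fun i => \dim {:V i}) mm') big_mkcond.
  by apply: leq_sum => j _; case: ifP.
rewrite -SN => Smax; apply/eqP; rewrite -leqn0 -(leq_add2l (S i)) addn0.
have -> : (S i + \dim {:V i})%N = S i.+1 by rewrite /S big_ord_recr.
exact: leq_trans Smax (leS _ _ Ni).
Qed.

Lemma big_tagged (V : nmodType) (J : finType) (T : J -> finType)
    (F : {j : J & T j} -> V) :
  \sum_c F c = \sum_j \sum_(z : T j) F (Tagged T z).
Proof. by rewrite sig_big_dep; apply: eq_bigr => -[]. Qed.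

Section Final.
Variables (k : fieldType) (char0 : [pchar k] =i pred0).
Variables (C : category) (P : finite_products C).
Variables (H : gr_functor k C) (c : cup_product H) (kun : kunneth P c).
Variables (X : C) (phi : gr_end (H X)) (d : nat).
Hypothesis X0 : forall i, (2 * d < i)%N -> \dim {:H X i} = 0%N.

Let N := (2 * d).+1.
Let I : finType := {i : 'I_N & 'I_(\dim {:H X i})}.
Let e (x : I) : homog (H X) := Homog (vbasis {:H X (tag x)})`_(tagged x).
Let l (x : I) (y : homog (H X)) : k :=
  coord (vbasis {:H X (tag x)}) (tagged x) (hcomp (tag x) y).
Let el : gr_frame e l.
Proof. exact: basis_frame X0. Qed.

Let A x y := l y (gr_app phi (e x)).
Let u := fpsX k.
Let odd_pt (x : I) := odd (tag x).
(** The rows of M are weighted so that a product of entries of M along f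
carries the power of -u that belongs to the degree of the cross product. *)
Let M (x y : I) : fps k := fpsC (A x y) * (- u) ^+ tag x.
Let B i : 'M[fps k]_(\dim {:H X i}) := u ^+ i *: map_mx (@fpsC k) (lfmx (phi i)).

Let A_out x y : tag x != tag y -> A x y = 0.
Proof. by move=> xy; rewrite /A (frame_deg el). Qed.

Let M_out x y : tag x != tag y -> M x y = 0.
Proof. by move=> xy; rewrite /M A_out //; apply: fpsP => n; rewrite fcoefCM mul0r. Qed.

Let M_even x y : odd_pt x != odd_pt y -> M x y = 0.
Proof. by move=> xy; apply: M_out; apply: contraNneq xy; rewrite /odd_pt => ->. Qed.

(** The factors $(-u)^i$ in $M$ multiply up to $(-u)^m$ for an index $f$ of total
degree $m$, the weight of degree $m$ in the Lefschetz series. *)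
Lemma ksum_lefschetz n : ksum odd_pt M n.+1 = lefschetz (pow_end_inv P c phi n) *+ n.+1`!.
Proof.
apply: fpsP => m; rewrite fcoefMn /= -mulrnAr.
rewrite (lftrace_pow_end char0 kun phi el) fcoef_sum mulr_sumr; apply: eq_bigr => g _.
rewrite fcoef_sum mulr_sumr [RHS]big_mkcond; apply: eq_bigr => f _.
have -> : \prod_i M (f i) (f (g i)) = fpsC (\prod_i A (f i) (f (g i))) *
    (fpsC ((-1) ^+ (\sum_i tag (f i))) * u ^+ (\sum_i tag (f i))).
  by rewrite fpsC_prod fpsC_sign -exprNn -prodrXr /M big_split.
rewrite -fpsC_sign !fcoefCM fcoefX.
rewrite eq_sym; case: eqP => [->|_]; last by rewrite !mulr0.
by rewrite mulr1 mulrA mulrC.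
Qed.

Lemma A_lfmx (i : 'I_N) (v w : 'I_(\dim {:H X i})) :
  A (Tagged (fun i : 'I_N => 'I_(\dim {:H X i})) v) (Tagged _ w) = lfmx (phi i) v w.
Proof. by rewrite lfmxE /A /l /= hcompE. Qed.

(** $M$ is block diagonal with blocks $(-u)^i \phi_i = (-1)^i B_i$, and the signs
in a walk cancel those of all its steps but one. *)
Lemma walk_diag n (i : 'I_N) (v w : 'I_(\dim {:H X i})) :
  walk odd_pt M n (Tagged (fun i : 'I_N => 'I_(\dim {:H X i})) v) (Tagged _ w) =
  (-1) ^+ i * (B i ^+ n.+1) v w.
Proof.
have ME (v' w' : 'I_(\dim {:H X i})) :
    M (Tagged (fun i : 'I_N => 'I_(\dim {:H X i})) v') (Tagged _ w') =
    (-1) ^+ i * B i v' w'.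
  rewrite /M A_lfmx /= [B i v' w']mxE [map_mx _ _ _ _]mxE [(- u) ^+ _]exprNn.
  by rewrite mulrCA [fpsC _ * _]mulrC.
elim: n v w => [|n IHn] v w; first by rewrite expr1 -ME.
rewrite [walk _ _ _ _ _]/= /odd_pt /= signr_odd; congr (_ * _).
rewrite exprS [RHS]mxE.
rewrite big_tagged.
rewrite (bigD1 i) //= [X in _ + X = _]big1 ?addr0 => [|j ji].
  by apply: eq_bigr => z _; rewrite ME IHn mulrACA -expr2 sqrr_sign mul1r.
by apply: big1 => z _; rewrite M_out ?mul0r 1?eq_sym.
Qed.

Lemma walk_lefschetz n : \sum_a walk odd_pt M n a a =
  \sum_(i < N) (-1) ^+ i * \tr (B i ^+ n.+1).
Proof.
rewrite big_tagged.
apply: eq_bigr => i _; rewrite /mxtrace mulr_sumr; apply: eq_bigr => v _.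
exact: walk_diag.
Qed.

Lemma det_factorE i : det_factor phi i = \det (1%:M - fpsX _ *: map_mx (@fpsC _) (B i)).
Proof. by rewrite /det_factor scale_map_fpsC. Qed.

(** Newton's identity, as a differential equation for the generating function. *)
Lemma theta_lefschetz_gen :
  theta (lefschetz_gen P c phi) =
  (\sum_(i < N) (-1) ^+ i * tracelog (B i)) * lefschetz_gen P c phi.
Proof.
set s := lefschetz_gen P c phi.
have ksE n : ksum odd_pt M n = fcoef s n *+ n`!.
  by case: n => [|n]; [apply: ksum0 | apply: ksum_lefschetz].
have -> : \sum_(i < N) (-1) ^+ i * tracelog (B i) =
    fpsX _ * Fps (fun n => \sum_a walk odd_pt M n a a).
  rewrite /tracelog; under eq_bigr do rewrite mulrCA.
  rewrite -mulr_sumr; congr (_ * _); apply: fpsP => n.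
  rewrite fcoef_sum [RHS]/= walk_lefschetz.
  apply: eq_bigr => i _.
  by rewrite -fpsC_sign fcoefCM.
apply: fpsP => -[|n]; first by rewrite -mulrA fcoef0XM /= mulr0n.
rewrite -mulrA fcoefXM -[LHS]/(fcoef s n.+1 *+ n.+1).
rewrite (ksum_newton M_even ksE) => [|m x]; last exact: fps_mulrn_eq0.
rewrite mulrC fcoefM [RHS](reindex_inj rev_ord_inj); apply: eq_bigr => i _ /=.
by rewrite subSS subKn // -ltnS.
Qed.

(** Multiplying by the even determinants cancels their logarithmic derivatives, and
what remains is the equation satisfied by the product of the odd ones. *)
Lemma lefschetz_gen_det :
  lefschetz_gen P c phi =
     (\prod_(i < d) det_factor phi (2 * i + 1)%N) /
     (\prod_(i < d.+1) det_factor phi (2 * i)%N).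
Proof.
set s := lefschetz_gen P c phi; set Num := \prod_(i < d) _; set Den := \prod_(i < d.+1) _.
have det0 i : fcoef (det_factor phi i) 0 = 1.
  by rewrite det_factorE fcoef0_det1B.
have Den0 : fcoef Den 0 = 1 by rewrite fcoef0_prod big1.
have Num0 : fcoef Num 0 = 1 by rewrite fcoef0_prod big1.
have DenU : Den \is a GRing.unit.
  by change (is_true (fcoef Den 0 \is a GRing.unit)); rewrite Den0 unitr1.
have thdet i : theta (det_factor phi i) = - tracelog (B i) * det_factor phi i.
  by rewrite det_factorE theta_det1B.
rewrite -[LHS](mulrK DenU); congr (_ / _).
pose Todd := \sum_(i < d) - tracelog (B (2 * i + 1)%N).
apply: (@theta_eq_uniq _ Todd).
- by move=> n x; apply: fps_mulrn_eq0.
- rewrite fcoef_sum big1 // => i _; by rewrite fcoefN fcoef0XM oppr0.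
- by rewrite fcoef0M Den0 Num0 mulr1.
- rewrite thetaM theta_lefschetz_gen -/s.
  rewrite (theta_prod (a := fun i : 'I_d.+1 => - tracelog (B (2 * i)%N))) //.
  rewrite (@sum_alternate _ (fun i => tracelog (B i)) (fun i v => (-1) ^+ i * v)).
  + rewrite [s * _]mulrCA -mulrA -mulrDl sumrN; congr (_ * _).
    by rewrite /Todd sumrN addrAC subrr add0r.
  + by move=> i v; rewrite mulnC exprM sqrr_sign mul1r.
  + by move=> i v; rewrite exprD mulnC exprM sqrr_sign mul1r expr1 mulN1r.
exact: theta_prod.
Qed.
End Final.

Theorem corollary1p5 (k : fieldType) (char0 : [pchar k] =i pred0)
    (C : category) (P : finite_products C) (H : gr_functor k C)
    (c : cup_product H) (kun : kunneth P c)
    (X : C) (phi : gr_end (H X)) (fin : gr_findim (H X)) :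
  (exists d : nat, forall i : nat, (2 * d < i)%N -> \dim {:H X i} = 0%N) /\
  (forall d : nat, (forall i : nat, (2 * d < i)%N -> \dim {:H X i} = 0%N) ->
     lefschetz_gen P c phi =
     (\prod_(i < d) det_factor phi (2 * i + 1)%N) /
     (\prod_(i < d.+1) det_factor phi (2 * i)%N)).
Proof.
split=> [|d X0]; last exact: lefschetz_gen_det.
have [N XN] := gr_findim_bound fin; exists N => i Ni; apply: XN.
by apply: leq_trans (ltnW Ni); rewrite leq_pmull.
Qed.
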